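(* Let $n\ge 2$ and let $\phi: M^n\to\mathbb{H}^{n+1}$ be a connected, compact, immersed, horospherically convex hypersurface (without boundary). Then $\phi$ can eventually be unfolded into an embedded hypersurface along its normal flow; that is, the leaves $\phi_t:M^n\to\mathbb{H}^{n+1}$ of the normal flow of $\phi$ are embedded for all sufficiently large $t$.
   Context: $\mathbb{R}^{1,n+1}$ is $\mathbb{R}^{n+2}$ with $\langle\bar x,\bar x\rangle=-x_0^2+\sum_{i=1}^{n+1}x_i^2$, and $\mathbb{H}^{n+1}=\{\bar x:\langle\bar x,\bar x\rangle=-1,\ x_0>0\}$. An immersed hypersurface $\phi:M^n\to\mathbb{H}^{n+1}$ is oriented by a unit normal field $\eta$, viewed as a map into $\{\bar x:\langle\bar x,\bar x\rangle=1\}$; its principal curvatures $\kappa_i$ are defined by $d\eta(e_i)=-\kappa_i\,d\phi(e_i)$ in an orthonormal basis of principal directions (so a geodesic sphere with outward normal has principal curvatures less than $-1$). $\phi$ is horospherically convex if at each $p$ the hypersurface lies locally on one side of the horosphere $\mathcal{H}_p$ tangent to it at $\phi(p)$ with inward normal $\eta(p)$, touches it (near $p$) only at $p$, and the distance to $\mathcal{H}_p$ does not vanish to second order in any direction; equivalently, at each point all $\kappa_i<1$ or all $\kappa_i>1$. By convention the orientation is chosen so that all $\kappa_i<1$ everywhere. The normal flow of $\phi$ is $\phi_t(p)=\exp_{\phi(p)}(t\,\eta(p))=\cosh t\,\phi(p)+\sinh t\,\eta(p)$, $t\in\mathbb{R}$. *)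

(* Defs.v *)
From HB Require Import structures.
From mathcomp Require Import all_boot all_order all_algebra.
From mathcomp Require Import all_classical all_reals all_analysis.

Set Implicit Arguments.
Unset Strict Implicit.
Unset Printing Implicit Defensive.

Import Order.TTheory GRing.Theory Num.Theory.
Import numFieldNormedType.Exports.

Local Open Scope classical_set_scope.
Local Open Scope ring_scope.

Section Smooth.
Context {R : realType} {V W : normedModType R}.

(* Iterated directional derivatives; on an open [U] of a finite-dimensional
   space this is the usual class C^k. *)
Fixpoint Ck (k : nat) (U : set V) (f : V -> W) : Prop :=
  if k is k'.+1 then
    (forall x, U x -> differentiable f x) /\
    (forall v, Ck k' U (fun x => 'D_v f x))
  else forall x, U x -> {for x, continuous f}.

Definition smooth_on (U : set V) (f : V -> W) : Prop := forall k, Ck k U f.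

End Smooth.

(* [chart_map] and [chart_inv] are total functions that are only meaningful on
   [chart_dom] and [chart_cod] respectively. *)
Record chart (R : realType) (n : nat) (M : topologicalType) := Chart {
  chart_dom : set M;
  chart_cod : set 'rV[R]_n;
  chart_map :> M -> 'rV[R]_n;
  chart_inv : 'rV[R]_n -> M;
  open_chart_dom : open chart_dom;
  open_chart_cod : open chart_cod;
  chart_map_cod : forall p, chart_dom p -> chart_cod (chart_map p);
  chart_inv_dom : forall u, chart_cod u -> chart_dom (chart_inv u);
  chart_mapK : forall p, chart_dom p -> chart_inv (chart_map p) = p;
  chart_invK : forall u, chart_cod u -> chart_map (chart_inv u) = u;
  chart_map_continuous : forall p, chart_dom p -> {for p, continuous chart_map};
  chart_inv_continuous : forall u, chart_cod u -> {for u, continuous chart_inv}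
}.

Section Manifold.
Context {R : realType} {n : nat} {M : topologicalType}.
Implicit Types (A : set (chart R n M)) (c : chart R n M) (p : M).

Definition smooth_atlas A : Prop :=
  (forall p, exists2 c, A c & chart_dom c p) /\
  (forall c d, A c -> A d ->
    smooth_on (chart_cod c `&` chart_inv c @^-1` chart_dom d)
      (d \o chart_inv c)).

Definition smooth_manifold A : Prop :=
  [/\ hausdorff_space M, @second_countable M & smooth_atlas A].

Context {m : nat}.
Implicit Types f : M -> 'rV[R]_m.

Definition smooth_map A f : Prop :=
  forall c, A c -> smooth_on (chart_cod c) (f \o chart_inv c).

(* df at p, applied to the tangent vector whose coordinates in the chart [c]
   are [v]. *)
Definition tangent_map c f p (v : 'rV[R]_n) : 'rV[R]_m :=
  'd (f \o chart_inv c) (c p) v.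

Definition immersion A f : Prop :=
  smooth_map A f /\
  (forall c p v, A c -> chart_dom c p -> tangent_map c f p v = 0 -> v = 0).

(* Injective and a homeomorphism onto the image: continuity follows from
   smoothness, and the last clause says that f is open onto its range. *)
Definition embedding A f : Prop :=
  [/\ immersion A f, injective f &
      forall U : set M, open U ->
        exists2 W : set 'rV[R]_m, open W & f @` U = range f `&` W].

End Manifold.

Section Hyperbolic.
Context {R : realType} {n : nat}.
Implicit Types x y a : 'rV[R]_n.+2.

Definition cosh (t : R) : R := (expR t + expR (- t)) / 2.
Definition sinh (t : R) : R := (expR t - expR (- t)) / 2.
Definition arcosh (t : R) : R := ln (t + Num.sqrt (t ^+ 2 - 1)).

Definition minkowski x y : R :=
  - (x 0 ord0 * y 0 ord0) +
  \sum_(i < n.+1) x 0 (lift ord0 i) * y 0 (lift ord0 i).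

Definition hyperbolic_space : set 'rV[R]_n.+2 :=
  [set x | minkowski x x = -1 /\ 0 < x 0 ord0].

Definition hdist x y : R := arcosh (- minkowski x y).

Definition hdist_set x (S : set 'rV[R]_n.+2) : R :=
  inf [set hdist x y | y in S].

(* For a future-directed null vector [a] this is a horosphere centred at the
   ideal point [a], bounding the horoball where minkowski x a > -1.  Its unit
   normal at x pointing into that horoball is a - x, so the horosphere through
   x with inward unit normal v is [horosphere (x + v)]. *)
Definition horosphere a : set 'rV[R]_n.+2 :=
  [set x | hyperbolic_space x /\ minkowski x a = -1].

End Hyperbolic.

Section Hypersurface.
Context {R : realType} {n : nat} {M : topologicalType}.
Variables (A : set (chart R n M)) (phi eta : M -> 'rV[R]_n.+2).

Definition immersed_hypersurface : Prop :=
  immersion A phi /\ (forall p, hyperbolic_space (phi p)).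

Definition embedded_hypersurface : Prop :=
  embedding A phi /\ (forall p, hyperbolic_space (phi p)).

Definition unit_normal_field : Prop :=
  [/\ smooth_map A eta,
      (forall p, minkowski (eta p) (eta p) = 1),
      (forall p, minkowski (eta p) (phi p) = 0) &
      (forall c p v, A c -> chart_dom c p ->
        minkowski (eta p) (tangent_map c phi p v) = 0)].

Definition principal_curvatures (p : M) (kappa : 'I_n -> R) : Prop :=
  exists (c : chart R n M) (e : 'I_n -> 'rV[R]_n),
    [/\ A c, chart_dom c p,
        (forall i j, minkowski (tangent_map c phi p (e i))
                               (tangent_map c phi p (e j)) = (i == j)%:R) &
        (forall i, tangent_map c eta p (e i) =
                   - kappa i *: tangent_map c phi p (e i))].

Definition tangent_horosphere (p : M) : set 'rV[R]_n.+2 :=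
  horosphere (phi p + eta p).

Definition locally_one_side (p : M) : Prop :=
  (\forall q \near p, minkowski (phi q) (phi p + eta p) <= -1) \/
  (\forall q \near p, minkowski (phi q) (phi p + eta p) >= -1).

Definition touches_only_at (p : M) : Prop :=
  \forall q \near p, tangent_horosphere p (phi q) -> q = p.

(* The distance to the horosphere has zero first derivative at p, so its
   second-order behaviour in a direction may be read along the coordinate
   segment of any chart. *)
Definition nonvanishing_second_order (p : M) : Prop :=
  forall c (v : 'rV[R]_n), A c -> chart_dom c p -> v != 0 ->
    ~ (hdist_set (phi (chart_inv c (c p + s *: v))) (tangent_horosphere p)
         / s ^+ 2 @[s --> (0 : R)^'] --> (0 : R)).

Definition horospherically_convex : Prop :=
  forall p, [/\ locally_one_side p, touches_only_at p &
                nonvanishing_second_order p].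

Definition orientation_convention : Prop :=
  forall p kappa, principal_curvatures p kappa -> forall i, kappa i < 1.

Definition normal_flow (t : R) (p : M) : 'rV[R]_n.+2 :=
  cosh t *: phi p + sinh t *: eta p.

End Hypersurface.

(* Main.v *)
(* The map [psi = phi + eta] takes values in the future light cone, and its
   direction is the hyperbolic Gauss map.  If [d psi v = 0], the distance from
   [phi] to the tangent horosphere vanishes to second order along [v]; hence
   horospherical convexity makes [psi] an immersion, and the Gauss map is a local
   diffeomorphism from a compact connected manifold to the sphere, [n >= 2].

   It is injective by a dynamical argument replacing covering theory.  Fix null
   vectors [a] and [b] and lift a Lorentz boost attracting towards [a] and
   repelling from [b], close to the identity, to a continuous map [step] on [M].
   Every point off the fibre over [b] converges to a point over [a] under [step],
   so the open basins of these points partition the complement of a discrete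
   set, which is connected since [n >= 2]; thus only one point lies over [a].

   Finally [phi_t = (e^t / 2) (psi + e^(-2t) chi)] with [chi = phi - eta], so for
   large [t] the leaf is a rescaled C^1-small perturbation of [psi], and it stays
   an injective immersion by compactness. *)

Require Import Defs.
From mathcomp Require Import all_boot all_order all_algebra.
From mathcomp Require Import all_classical all_reals all_analysis.
From mathcomp Require Import ring lra.
Import Defs.
Set Implicit Arguments.
Unset Strict Implicit.
Unset Printing Implicit Defensive.

Import Order.TTheory GRing.Theory Num.Theory.
Import numFieldNormedType.Exports.
Local Open Scope classical_set_scope.
Local Open Scope ring_scope.

(** * Minkowski space *)

(** No sphere at infinity is constructed: two future null vectors have the same ideal point exactly
    when their Minkowski product vanishes, and every statement on the Gauss map is phrased by this
    equation. Two local facts carry the argument. Local injectivity holds because parallel null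
    vectors have a null difference, whereas [psi] at distinct nearby points has a spacelike
    difference. Openness comes from minimising [- <psi, y>] over a small ball, in place of an
    inverse function. Together they lift a boost: openness yields a solution near each point, local
    injectivity makes it unique, compactness makes both uniform. The boost multiplies products with
    [a] by [k^-1] and products with [b] by [k], so their ratio contracts by [k^-2] at each step,
    whatever positive factor separates [psi (step p)] from the boosted vector. This contraction
    drives the convergence. *)

Section Minkowski.
Context {R : realType} {n : nat}.
Implicit Types x y z a b : 'rV[R]_n.+2.

Lemma minkC x y : minkowski x y = minkowski y x.
Proof.
by rewrite /minkowski mulrC; congr (_ + _); apply: eq_bigr => i _; rewrite mulrC.
Qed.

Lemma minkDl x y z : minkowski (x + y) z = minkowski x z + minkowski y z.
Proof.
rewrite /minkowski !mxE mulrDl opprD.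
under eq_bigr do rewrite !mxE mulrDl.
by rewrite big_split /= addrACA.
Qed.

Lemma minkZl (k : R) x y : minkowski (k *: x) y = k * minkowski x y.
Proof.
rewrite /minkowski !mxE mulrDr mulr_sumr mulrN mulrA.
by congr (_ + _); apply: eq_bigr => i _; rewrite !mxE mulrA.
Qed.

Lemma minkDr x y z : minkowski x (y + z) = minkowski x y + minkowski x z.
Proof. by rewrite minkC minkDl !(minkC x). Qed.

Lemma minkZr (k : R) x y : minkowski x (k *: y) = k * minkowski x y.
Proof. by rewrite minkC minkZl (minkC x). Qed.

Lemma minkNl x y : minkowski (- x) y = - minkowski x y.
Proof. by rewrite -scaleN1r minkZl mulN1r. Qed.

Lemma minkNr x y : minkowski x (- y) = - minkowski x y.
Proof. by rewrite minkC minkNl (minkC x). Qed.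

Lemma mink0l x : minkowski 0 x = 0.
Proof. by rewrite -(scale0r 0) minkZl mul0r. Qed.

Lemma mink0r x : minkowski x 0 = 0.
Proof. by rewrite minkC mink0l. Qed.

Definition minkE := (minkDl, minkDr, minkNl, minkNr, minkZl, minkZr).

Lemma mink_spatial_ge0 x : x 0 ord0 = 0 -> 0 <= minkowski x x.
Proof.
rewrite /minkowski => ->; rewrite mul0r oppr0 add0r sumr_ge0// => i _.
by rewrite -expr2 sqr_ge0.
Qed.

Lemma mink_spatial_eq0 x : x 0 ord0 = 0 -> minkowski x x = 0 -> x = 0.
Proof.
rewrite /minkowski => x0; rewrite x0 mul0r oppr0 add0r => /eqP.
rewrite psumr_eq0; last by move=> i _; rewrite -expr2 sqr_ge0.
move=> /allP h; apply/rowP => i; rewrite mxE.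
have [j ->|->//] := unliftP ord0 i.
by have := h j (mem_index_enum j); rewrite -expr2 sqrf_eq0 => /eqP.
Qed.

(* The time coordinate of [y_0 x - x_0 y] vanishes; its square is thus nonnegative. *)
Lemma mink_cross_ge0 x y :
  0 <= (y 0 ord0) ^+ 2 * minkowski x x + (x 0 ord0) ^+ 2 * minkowski y y
       - 2 * x 0 ord0 * y 0 ord0 * minkowski x y.
Proof.
have := @mink_spatial_ge0 (y 0 ord0 *: x - x 0 ord0 *: y).
rewrite !mxE => /(_ ltac:(ring)); rewrite !minkE (minkC y x).
by move=> h; apply: le_trans h _; rewrite le_eqVlt; apply/orP; left; apply/eqP; ring.
Qed.

Lemma mink_cross_eq0 x y :
  (y 0 ord0) ^+ 2 * minkowski x x + (x 0 ord0) ^+ 2 * minkowski y y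
    - 2 * x 0 ord0 * y 0 ord0 * minkowski x y = 0 ->
  y 0 ord0 *: x = x 0 ord0 *: y.
Proof.
move=> h; apply/eqP; rewrite -subr_eq0; apply/eqP.
apply: mink_spatial_eq0; first by rewrite !mxE; ring.
by rewrite !minkE (minkC y x) -h; ring.
Qed.

Lemma null_sub x y : minkowski x x = 0 -> minkowski y y = 0 ->
  minkowski (x - y) (x - y) = - 2 * minkowski x y.
Proof. by move=> xx yy; rewrite !minkE xx yy (minkC y x); ring. Qed.

Definition future_null x := minkowski x x = 0 /\ 0 < x 0 ord0.

Lemma future_null_le0 x y : future_null x -> future_null y -> minkowski x y <= 0.
Proof.
move=> [xx x0] [yy y0]; have := mink_cross_ge0 x y; rewrite xx yy.
have := mulr_gt0 x0 y0; nra.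
Qed.

(** The equality case of [mink_cross_ge0]. It is what lets a vanishing product stand for equality of
    null directions; the next lemma is transitivity of that relation. *)
Lemma future_null_parallel {x y} : future_null x -> future_null y ->
  minkowski x y = 0 -> y 0 ord0 *: x = x 0 ord0 *: y.
Proof. by move=> [xx x0] [yy y0] xy; apply: mink_cross_eq0; rewrite xx yy xy; ring. Qed.

Lemma future_null_parallel_trans x y z :
  future_null x -> future_null y -> future_null z ->
  minkowski x y = 0 -> minkowski y z = 0 -> minkowski x z = 0.
Proof.
move=> fx fy fz xy yz; have e := future_null_parallel fx fy xy.
have : minkowski (y 0 ord0 *: x) z = 0 by rewrite e minkZl yz mulr0.
by rewrite minkZl => /eqP; rewrite mulf_eq0 gt_eqF ?fy.2//= => /eqP.
Qed.

(** Tangent spaces of the hyperboloid are spacelike: [mink_cross_ge0] becomes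
    [x_0^2 <y, y> >= y_0^2]. *)
Lemma hyperbolic_tangent_ge0 x y : hyperbolic_space x -> minkowski y x = 0 ->
  0 <= minkowski y y.
Proof.
move=> [xx x0] yx; have := mink_cross_ge0 y x; rewrite xx yx => h.
rewrite -(pmulr_rge0 _ (exprn_gt0 2 x0)); have := sqr_ge0 (y 0 ord0); nra.
Qed.

Lemma hyperbolic_tangent_eq0 {x y} : hyperbolic_space x -> minkowski y x = 0 ->
  minkowski y y = 0 -> y = 0.
Proof.
move=> [xx x0] yx yy; have := mink_cross_ge0 y x; rewrite xx yy yx => h.
apply: mink_spatial_eq0 => //; apply/eqP; rewrite -sqrf_eq0 eq_le sqr_ge0 andbT.
by nra.
Qed.

(** Reversed Cauchy-Schwarz, from [2 x_0 y_0 <= x_0^2 + y_0^2]; it keeps the argument of [arcosh] in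
    [hdist] at least 1. *)
Lemma hyperbolic_mink_le x y : hyperbolic_space x -> hyperbolic_space y ->
  1 <= - minkowski x y.
Proof.
move=> [xx x0] [yy y0]; have := mink_cross_ge0 x y; rewrite xx yy => h.
rewrite -(ler_pM2l (mulr_gt0 x0 y0)); have := sqr_ge0 (x 0 ord0 - y 0 ord0); nra.
Qed.

Lemma hyperbolic_mink_lt0 x y : hyperbolic_space x -> minkowski y y = -1 ->
  minkowski x y < 0 -> hyperbolic_space y.
Proof.
move=> [xx x0] yy xy; split => //; have := mink_cross_ge0 x y; rewrite xx yy => h.
rewrite ltNge; apply/negP => y0.
have : 0 < (x 0 ord0) ^+ 2 by rewrite exprn_gt0.
have := sqr_ge0 (y 0 ord0).
have : 0 <= (x 0 ord0 * - y 0 ord0) * - minkowski x y.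
  by rewrite mulr_ge0 ?mulr_ge0 ?oppr_ge0// ltW.
by nra.
Qed.

(** The cross inequality bounds [|y_0|] by [x_0], so the time coordinate is nonnegative. If it were
    0, the null vector [x + y] would vanish, against [<x + y, x> = -1]. *)
Lemma normal_sum_future_null x y : hyperbolic_space x -> minkowski y y = 1 ->
  minkowski y x = 0 -> future_null (x + y).
Proof.
move=> [xx x0] yy yx.
have n0 : minkowski (x + y) (x + y) = 0 by rewrite !minkE (minkC x y) xx yy yx; ring.
split => //; have := mink_cross_ge0 y x; rewrite xx yy yx => h.
have : 0 <= (x + y) 0 ord0.
  rewrite mxE; have : `|y 0 ord0| <= `|x 0 ord0|.
    by rewrite -ler_sqr ?nnegrE// !real_normK ?num_real//; lra.
  by rewrite (gtr0_norm x0) ler_norml => /andP[]; lra.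
rewrite le_eqVlt => /orP[/eqP/esym z|//].
have : minkowski (x + y) x = -1 by rewrite minkDl xx yx addr0.
by rewrite (mink_spatial_eq0 z n0) mink0l => /eqP; rewrite eq_sym oppr_eq0 oner_eq0.
Qed.

Lemma cvg_mink_coord {I : Type} {F : set_system I} {FF : Filter F}
  (f g : I -> 'rV[R]_n.+2) x y :
  (forall j, f i 0 j @[i --> F] --> x 0 j) -> (forall j, g i 0 j @[i --> F] --> y 0 j) ->
  minkowski (f i) (g i) @[i --> F] --> minkowski x y.
Proof.
move=> fx gy; apply: cvgD; first by apply: cvgN; exact: cvgM.
by apply: cvg_big => [|i _]; [exact: add_continuous|exact: cvgM].
Qed.

Lemma cvg_coord0 {I : Type} {F : set_system I} {FF : Filter F}
    (f : I -> 'rV[R]_n.+2) (x : 'rV[R]_n.+2) j : f @ F --> x -> f i 0 j @[i --> F] --> x 0 j.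
Proof.
move=> fx; apply: (@cvg_comp _ _ _ f (fun M : 'rV[R]_n.+2 => M 0 j)) fx _.
exact: coord_continuous.
Qed.

Lemma cvg_mink {I : Type} {F : set_system I} {FF : Filter F}
  (f g : I -> 'rV[R]_n.+2) x y : f @ F --> x -> g @ F --> y ->
  minkowski (f i) (g i) @[i --> F] --> minkowski x y.
Proof. by move=> fx gy; apply: cvg_mink_coord => j; exact: cvg_coord0. Qed.

End Minkowski.

(** * Injectivity of the Gauss map *)

Section GeneralTopology.
Context {T : topologicalType}.

Lemma open_disjoint_separated (A B : set T) : open A -> open B ->
  A `&` B = set0 -> separated A B.
Proof.
move=> oA oB AB; split; rewrite -subset0 => x.
  by case=> /(_ B); rewrite AB => h Bx; have [|] := h _ => //; exact: open_nbhs_nbhs.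
by case=> Ax /(_ A); rewrite setIC AB => h; have [|] := h _ => //; exact: open_nbhs_nbhs.
Qed.

(** On a compact Hausdorff space these are the entourages of its uniformity. As a filter they can be
    the parameter of the near-covering form of compactness. *)
Definition diagonal_nbhs : set_system (T * T) := [set S | forall p : T, nbhs ((p, p) : T * T) S].

Lemma diagonal_nbhs_proper (p : T) : ProperFilter diagonal_nbhs.
Proof.
apply: Build_ProperFilter_ex.
  by move=> S /(_ p) /nbhs_singleton; exists (p, p).
split; first by move=> q; exact: filterT.
  by move=> A B hA hB q; exact: filterI.
by move=> A B AB hA q; exact: filterS (hA q).
Qed.

Lemma iter_continuous (f : T -> T) (j : nat) : continuous f -> continuous (iter j f).
Proof.
move=> fc; elim: j => [|j ih] p; first exact: cvg_id.
by apply: continuous_comp; [exact: ih|exact: fc].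
Qed.

Lemma iter_cvg_shift (f : T -> T) (j0 : nat) (p x : T) :
  iter j f (iter j0 f p) @[j --> \oo] --> x -> iter j f p @[j --> \oo] --> x.
Proof.
move=> h; have : (fun j => iter (j - j0) f (iter j0 f p)) @ \oo --> x.
  by apply: (@cvg_comp _ _ _ (subn^~ j0)) h; exact: cvg_subnr.
apply: cvg_trans; apply: near_eq_cvg; near=> j.
by rewrite -iterD subnK//; near: j; exists j0.
Unshelve. all: by end_near. Qed.

(** A Lebesgue number argument: the local neighbourhoods are replaced by the slices of one
    neighbourhood [W] of the diagonal. *)
Lemma compact_uniform_injectivity (r : T -> T -> Prop) (p0 : T) :
  hausdorff_space T -> compact [set: T] ->
  (forall p : T, \forall q \near p & q' \near p, r q q' -> q = q') ->
  exists W : set (T * T), [/\ open W, forall p, W (p, p) &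
    forall p q q', W (p, q) -> W (p, q') -> r q q' -> q = q'].
Proof.
move=> hd cpt inj; have PF := diagonal_nbhs_proper p0.
have nc := (@compact_near_coveringP T [set: T]).1 cpt.
have : \forall S \near powerset_filter_from diagonal_nbhs,
    [set: T] `<=` fun p => forall q q', S (p, q) -> S (p, q') -> r q q' -> q = q'.
  apply: nc => p _.
  have [[A B] /= [Ap Bp] ABr] := inj p.
  have Op : nbhs p (A `&` B)° by apply: nbhs_interior; exact: filterI.
  have reg : {for p, regular_space T}.
    by apply: (@compact_regular _ _ setT) => //; exact: filterT.
  have [C Cp CO] := reg _ Op.
  (* Over the closed neighbourhood [closure C] of [p] the slices of [S0] lie in the good set;
     elsewhere they are unrestricted. Regularity is what makes [S0] a neighbourhood of the
     diagonal. *)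
  pose S0 : set (T * T) := [set z | closure C z.1 -> (A `&` B)° z.2].
  have S0d : diagonal_nbhs S0.
    move=> y; have [Cy|nCy] := pselect (closure C y).
      exists (setT, (A `&` B)°); last by move=> [u v] [_ Ov] _; exact: Ov.
      split; first exact: filterT.
      by apply: open_nbhs_nbhs; split; [exact: open_interior|exact: CO].
    exists (~` closure C, setT); last by move=> [u v] [nCu _] /nCu.
    split; last exact: filterT.
    by apply: open_nbhs_nbhs; split => //; exact/closed_openC/closed_closure.
  near=> p' S => q q' Sq Sq' rqq'.
  have SS0 : S `<=` S0 by near: S; exact: small_set_sub.
  have Cp' : closure C p' by apply: (@subset_closure _ C); near: p'; exact: Cp.
  apply: (ABr (q, q')) => //=.
  by split; [have /interior_subset[] := SS0 _ Sq Cp'|have /interior_subset[] := SS0 _ Sq' Cp'].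
move=> ncS; have [S [Sd Sinj]] := filter_ex (filterI (near_small_set PF) ncS).
exists S°; split; first exact: open_interior.
  by move=> p; rewrite /interior; exact: Sd.
by move=> p q q' /interior_subset Sq /interior_subset Sq'; exact: (Sinj p I q q').
Unshelve. all: by end_near. Qed.

End GeneralTopology.

(** * Lorentz boosts attached to two null directions *)

Section Boost.
Context {R : realType} {n : nat}.
Implicit Types x a b : 'rV[R]_n.+2.

(* The Lorentz boost scaling the null vector [a] by [k] and the null vector [b]
   by [k^-1], and fixing their orthogonal complement. *)
Definition boost a b (k : R) x : 'rV[R]_n.+2 :=
  x + ((k - 1) * (minkowski x b / minkowski a b)) *: a
    + ((k^-1 - 1) * (minkowski x a / minkowski a b)) *: b.

Context {a b : 'rV[R]_n.+2}.
Hypotheses (aa : minkowski a a = 0) (bb : minkowski b b = 0) (ab : minkowski a b != 0).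

Lemma minkowski_boost_attracting k x : k != 0 ->
  minkowski (boost a b k x) a = k^-1 * minkowski x a.
Proof.
by move=> k0; rewrite /boost !minkE (minkC b a) aa; field; rewrite ?k0 ?ab.
Qed.

Lemma minkowski_boost_repelling k x : k != 0 ->
  minkowski (boost a b k x) b = k * minkowski x b.
Proof. by move=> k0; rewrite /boost !minkE bb; field; rewrite ?k0 ?ab. Qed.

Lemma minkowski_boost k x : k != 0 ->
  minkowski (boost a b k x) (boost a b k x) = minkowski x x.
Proof.
move=> k0; rewrite /boost !minkE (minkC b a) (minkC a x) (minkC b x) aa bb.
by field; rewrite ?k0 ?ab.
Qed.

Lemma boost1 x : boost a b 1 x = x.
Proof. by rewrite /boost invr1 subrr !mul0r !scale0r !addr0. Qed.

Lemma cvg_boost {I : Type} {F : set_system I} {FF : Filter F} (f : I -> 'rV[R]_n.+2)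
    (g : I -> R) x k : k != 0 -> f @ F --> x -> g @ F --> k ->
  boost a b (g i) (f i) @[i --> F] --> boost a b k x.
Proof.
move=> k0 fx gk.
have cm (c : 'rV[R]_n.+2) : minkowski (f i) c @[i --> F] --> minkowski x c.
  by apply: cvg_mink => //; exact: cvg_cst.
apply: cvgD; first (apply: cvgD => //); apply: cvgZr_tmp; apply: cvgM.
- by apply: cvgB => //; exact: cvg_cst.
- by apply: cvgM; [exact: cm|exact: cvg_cst].
- by apply: cvgB; [exact: cvgV|exact: cvg_cst].
- by apply: cvgM; [exact: cm|exact: cvg_cst].
Qed.

End Boost.

Lemma minkowski_delta_time {R : realType} {n : nat} (a : 'rV[R]_n.+2) :
  minkowski (delta_mx 0 ord0) a = - a 0 ord0.
Proof.
rewrite /minkowski big1 => [|i _]; first by rewrite addr0 mxE !eqxx mul1r.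
by rewrite mxE /= mul0r.
Qed.

(** The witness is [a] with its spatial part reversed, and [<a, b> = - 2 a_0^2]. *)
Lemma future_null_opposite {R : realType} {n : nat} (a : 'rV[R]_n.+2) :
  future_null a -> exists2 b, future_null b & minkowski a b != 0.
Proof.
move=> [aa a0]; exists (2 * a 0 ord0 *: delta_mx 0 ord0 - a).
  split; last by rewrite !mxE !eqxx/= mulr1; lra.
  by rewrite !minkE aa (minkC a) !minkowski_delta_time mxE !eqxx /=; ring.
rewrite minkDr minkZr minkNr aa (minkC a) minkowski_delta_time.
by rewrite subr0 mulrN oppr_eq0 !mulf_neq0// gt_eqF.
Qed.

(** * Dynamics of a lifted boost *)

Section Injectivity.
Context {R : realType} {n : nat} {M : topologicalType} {psi : M -> 'rV[R]_n.+2}.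
Hypotheses (M_hausdorff : hausdorff_space M) (M_compact : compact [set: M])
  (M_connected : connected [set: M]).
Hypotheses (psi_continuous : continuous psi) (psi_null : forall p, future_null (psi p)).
Hypothesis psi_open : forall (p : M) (O : set M) (y0 : 'rV[R]_n.+2), nbhs p O ->
  future_null y0 -> minkowski (psi p) y0 = 0 ->
  \forall y \near y0, future_null y -> exists2 q, O q & minkowski (psi q) y = 0.
Hypothesis psi_locally_injective : forall p : M, \forall q \near p & q' \near p,
  minkowski (psi q) (psi q') = 0 -> q = q'.
Hypothesis punctured_nbhs_connected : forall (z : M) (O : set M), nbhs z O ->
  exists V : set M, [/\ open V, V z, V `<=` O, connected (V `\ z) & (V `\ z) !=set0].

Section Dynamics.
Context {a b : 'rV[R]_n.+2}.
Hypotheses (a_null : future_null a) (b_null : future_null b) (ab : minkowski a b != 0).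
Context {W : set (M * M)}.
Hypotheses (W_open : open W) (W_refl : forall p, W (p, p))
  (W_inj : forall p q q', W (p, q) -> W (p, q') -> minkowski (psi q) (psi q') = 0 -> q = q').

(** Both quantities are nonnegative and scale with [psi p], so only their ratio depends on the null
    direction alone. [depth] vanishes exactly over the ray of [a], [height] exactly over the ray of
    [b]. *)
Let height p := - minkowski (psi p) b.
Let depth p := - minkowski (psi p) a.

Let height_ge0 p : 0 <= height p.
Proof. by rewrite oppr_ge0; exact: future_null_le0. Qed.

Let depth_ge0 p : 0 <= depth p.
Proof. by rewrite oppr_ge0; exact: future_null_le0. Qed.

Let height_continuous : continuous height.
Proof.
by move=> p; apply: cvgN; apply: cvg_mink; [exact: psi_continuous|exact: cvg_cst].
Qed.

Let depth_continuous : continuous depth.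
Proof.
by move=> p; apply: cvgN; apply: cvg_mink; [exact: psi_continuous|exact: cvg_cst].
Qed.

Let height_gt0 p : depth p = 0 -> 0 < height p.
Proof.
move=> /eqP; rewrite oppr_eq0 => /eqP pa; rewrite lt0r height_ge0 andbT oppr_eq0.
apply: contra ab => /eqP pb; apply/eqP.
by apply: (@future_null_parallel_trans _ _ _ (psi p)) => //; rewrite minkC.
Qed.

(** At [k = 1] the boost is the identity and [q = p] is a solution. Openness of [psi] carries this
    to nearby points and parameters, and compactness of [M] gives one [k] for all points. *)
Lemma boost_step : exists2 k : R, 1 < k & forall p, future_null (boost a b k (psi p)) /\
  exists2 q, W (p, q) & minkowski (psi q) (boost a b k (psi p)) = 0.
Proof.
have nc := (@compact_near_coveringP M [set: M]).1 M_compact.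
have : \forall k \near (1 : R)^'+, [set: M] `<=` fun p => future_null (boost a b k (psi p)) /\
    exists2 q, W (p, q) & minkowski (psi q) (boost a b k (psi p)) = 0.
  apply: nc => p _.
  have : nbhs ((p, p) : M * M) W by apply: open_nbhs_nbhs.
  move=> [[A B] /= [Ap Bp] ABW].
  have cB : boost a b z.2 (psi z.1) @[z --> filter_prod (nbhs p) (1 : R)^'+] --> psi p.
    rewrite -[X in _ --> X](@boost1 _ _ a b); apply: cvg_boost => //.
      by apply: (@cvg_comp _ _ _ fst psi) (psi_continuous (x:=p)); exact: cvg_fst.
    by apply: cvg_trans cvg_snd _; exact: cvg_within.
  have sol : \forall z \near filter_prod (nbhs p) (1 : R)^'+,
      future_null (boost a b z.2 (psi z.1)) ->
      exists2 q, B q & minkowski (psi q) (boost a b z.2 (psi z.1)) = 0.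
    exact: cB _ (psi_open Bp (psi_null p) (psi_null p).1).
  have pos : \forall z \near filter_prod (nbhs p) (1 : R)^'+,
      0 < (boost a b z.2 (psi z.1)) 0 ord0.
    by apply: cvgr_gt (psi_null p).2; exact: cvg_coord0 cB.
  have near_p : \forall z \near filter_prod (nbhs p) (1 : R)^'+, A z.1.
    exact: (@cvg_fst _ _ _ (1 : R)^'+ _ A Ap).
  have near_k : \forall z \near filter_prod (nbhs p) (1 : R)^'+, 1 < z.2.
    exact: (@cvg_snd _ _ (nbhs p) _ _ _ (nbhs_right_gt (1 : R))).
  apply: filterS (filterI (filterI sol pos) (filterI near_p near_k)) => -[p' k] /=.
  move=> [[solk posk] [Ap' k1]].
  have fn : future_null (boost a b k (psi p')).
    split => //; rewrite minkowski_boost ?(psi_null p').1 ?a_null.1 ?b_null.1 //.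
    by rewrite gt_eqF// (lt_trans ltr01).
  split => //; have [q Bq qk] := solk fn; exists q => //.
  exact: (ABW (p', q)).
move=> step; have [k [k1 stepk]] := filter_ex (filterI (nbhs_right_gt (1 : R)) step).
by exists k => // p; exact: stepk.
Qed.

Context {k : R} (k1 : 1 < k) {step : M -> M}.
Hypotheses (boost_null : forall p, future_null (boost a b k (psi p)))
  (W_step : forall p, W (p, step p))
  (psi_step : forall p, minkowski (psi (step p)) (boost a b k (psi p)) = 0).

Let k_gt0 : 0 < k. Proof. exact: lt_trans ltr01 k1. Qed.
Let k_neq0 : k != 0. Proof. by rewrite gt_eqF. Qed.

Lemma step_unique p q : W (p, q) -> minkowski (psi q) (boost a b k (psi p)) = 0 -> step p = q.
Proof.
move=> Wq pq; apply: W_inj (W_step p) Wq _.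
apply: (@future_null_parallel_trans _ _ _ (boost a b k (psi p))) => //.
by rewrite minkC.
Qed.

(** [step] is obtained by choice, so continuity must come from uniqueness: openness produces a
    solution close to [step p], and [step_unique] identifies it with [step q]. *)
Lemma step_continuous : continuous step.
Proof.
move=> p O Op; have : nbhs ((p, step p) : M * M) W by apply: open_nbhs_nbhs.
move=> [[A B] /= [Ap Bp] ABW].
have OBp : nbhs (step p) (O `&` B) by exact: filterI.
have sol := psi_open OBp (boost_null p) (psi_step p).
have cB : boost a b k (psi q) @[q --> p] --> boost a b k (psi p).
  by apply: cvg_boost => //; [exact: psi_continuous|exact: cvg_cst].
have near_sol : \forall q \near p, future_null (boost a b k (psi q)) ->
    exists2 r, (O `&` B) r & minkowski (psi r) (boost a b k (psi q)) = 0 by exact: cB _ sol.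
apply: filterS (filterI near_sol Ap) => q [/(_ (boost_null q))[r [Or Br] rq] Aq] /=.
by rewrite (@step_unique _ r) //; exact: (ABW (q, r)).
Qed.

Lemma step_fixed x : depth x = 0 -> step x = x.
Proof.
move=> /eqP; rewrite oppr_eq0 => /eqP xa; apply: step_unique => //.
apply: (@future_null_parallel_trans _ _ _ a) => //.
by rewrite minkC minkowski_boost_attracting ?a_null.1// xa mulr0.
Qed.

(** The contraction of [depth / height] by [k^-2], in a product form that stays meaningful where
    [height] vanishes. The unknown factor between [psi (step p)] and the boosted vector is positive
    and cancels. *)
Lemma step_ratio c p : depth p < c * height p -> depth (step p) < c / k ^+ 2 * height (step p).
Proof.
move=> pc; have e := future_null_parallel (psi_null _) (boost_null p) (psi_step p).
set u := (X in X *: psi (step p)) in e; set v := (X in _ = X *: _) in e.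
have u0 : 0 < u by exact: (boost_null p).2.
have v0 : 0 < v by exact: (psi_null _).2.
have ed : u * depth (step p) = v * (k^-1 * depth p).
  by rewrite /depth mulrN -minkZl e minkZl minkowski_boost_attracting ?a_null.1// !mulrN.
have eh : u * height (step p) = v * (k * height p).
  by rewrite /height mulrN -minkZl e minkZl minkowski_boost_repelling ?b_null.1// !mulrN.
rewrite -(ltr_pM2l u0) [u * (_ * _)]mulrCA eh ed [c / _ * _]mulrCA ltr_pM2l//.
have -> : c / k ^+ 2 * (k * height p) = k^-1 * (c * height p) by field.
by rewrite ltr_pM2l// invr_gt0.
Qed.

Lemma iter_step_ratio c p j : depth p < c * height p ->
  depth (iter j step p) < c / k ^+ 2 ^+ j * height (iter j step p).
Proof.
move=> pc; elim: j => [|j ih]; first by rewrite expr0 divr1.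
by rewrite iterS exprSr invfM mulrA; exact: step_ratio.
Qed.

Lemma iter_step_small p (d : R) : 0 < height p -> 0 < d ->
  \forall j \near \oo, depth (iter j step p) < d * height (iter j step p).
Proof.
(* The [+ 1] only makes the initial bound strict. *)
move=> hp d0; pose c := depth p / height p + 1.
have pc : depth p < c * height p by rewrite mulrDl divfK ?gt_eqF// mul1r ltrDl.
have : c * (k ^- 2) ^+ j @[j --> \oo] --> c * 0.
  apply: cvgM; first exact: cvg_cst.
  apply: cvg_expr; rewrite ger0_norm ?invr_ge0 ?exprn_ge0 ?ltW//.
  by rewrite invf_lt1 ?exprn_gt0// exprn_egt1.
rewrite mulr0 => /cvgr_lt /(_ _ d0) cd.
apply: filterS cd => j cjd; apply: lt_le_trans (iter_step_ratio j pc) _.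
by rewrite ler_wpM2r// -exprVn ltW.
Qed.

Let near_fst (A : set M) (q : M) : nbhs q A ->
  \forall z \near filter_prod (nbhs q) (0 : R)^'+, A z.1.
Proof. exact: cvg_fst. Qed.

(** Settles the covering arguments below away from the fibre over [a]: near such [q] the premise
    [depth < d * height] fails for small [d]. *)
Let near_depth_gt (q : M) : depth q != 0 ->
  \forall z \near filter_prod (nbhs q) (0 : R)^'+, ~ depth z.1 < z.2 * height z.1.
Proof.
move=> q0.
have cd : depth z.1 - z.2 * height z.1 @[z --> filter_prod (nbhs q) (0 : R)^'+]
      --> depth q - 0 * height q.
  apply: cvgB.
    by apply: (@cvg_comp _ _ _ fst depth) (depth_continuous (x:=q)); exact: cvg_fst.
  apply: cvgM.
    by apply: cvg_trans cvg_snd _; exact: cvg_within.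
  by apply: (@cvg_comp _ _ _ fst height) (height_continuous (x:=q)); exact: cvg_fst.
rewrite mul0r subr0 in cd.
have dq : 0 < depth q by rewrite lt0r q0 depth_ge0.
apply: filterS (cvgr_gt _ cd _ dq) => -[q' d] /=.
by rewrite subr_gt0 => h1 h2; have := lt_trans h1 h2; rewrite ltxx.
Qed.

(** A small ratio means a direction close to that of [a], and such directions are attained in [O]
    because [psi] is open at [x]. Compactness makes [d] uniform in [q]. *)
Lemma fiber_near (x : M) (O : set M) : depth x = 0 -> nbhs x O ->
  exists2 d : R, 0 < d & forall q, depth q < d * height q ->
    exists2 q', O q' & minkowski (psi q') (psi q) = 0.
Proof.
move=> x0 Ox; have nc := (@compact_near_coveringP M [set: M]).1 M_compact.
have : \forall d \near (0 : R)^'+, [set: M] `<=` fun q => depth q < d * height q ->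
    exists2 q', O q' & minkowski (psi q') (psi q) = 0.
  apply: nc => q _; have [q0|q0] := eqVneq (depth q) 0.
    have : minkowski (psi x) (psi q) = 0.
      apply: (@future_null_parallel_trans _ _ _ a) => //.
        by apply/eqP; rewrite -oppr_eq0; apply/eqP.
      by rewrite minkC; apply/eqP; rewrite -oppr_eq0; apply/eqP.
    move=> /(psi_open Ox (psi_null q)) sol.
    have near_q := psi_continuous sol.
    apply: filterS (near_fst near_q) => -[q' d] /= solq _.
    exact: solq.
  by apply: filterS (near_depth_gt q0) => -[q' d] /= h /h.
move=> cov; have [d [d0 covd]] := filter_ex (filterI (nbhs_right_gt (0 : R)) cov).
by exists d => // q; exact: covd.
Qed.

Let to_fiber (x : M) := [set p | iter j step p @[j --> \oo] --> x].

(** Near [x], injectivity of [psi] identifies a point with any solution supplied by [fiber_near], so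
    a small ratio locates the point itself. Hence a neighbourhood cut down by a ratio bound is
    trapped by [step], and the shrinking ratio pushes its orbits into every neighbourhood of [x]. *)
Lemma near_to_fiber x : depth x = 0 -> nbhs x (to_fiber x).
Proof.
move=> x0; have [[A B] /= [Ax Bx] ABinj] := psi_locally_injective x.
have ABx : nbhs x (A `&` B) by exact: filterI.
have step_x : \forall q \near x, (A `&` B) (step q).
  by apply: step_continuous; rewrite step_fixed.
(* The condition on [step q] is put into the target set: once the solution found there is identified
   with a given point, that point's image is known to stay. *)
have stay_nbhs : nbhs x ((A `&` B) `&` [set q | (A `&` B) (step q)]) by exact: filterI.
have [d d0 solve] := fiber_near x0 stay_nbhs.
have small : \forall q \near x, depth q < d * height q.
  have cd : d * height q - depth q @[q --> x] --> d * height x - depth x.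
    apply: cvgB; last exact: depth_continuous.
    by apply: cvgM; [exact: cvg_cst|exact: height_continuous].
  have : 0 < d * height x - depth x by rewrite x0 subr0 mulr_gt0// height_gt0.
  by move=> h; apply: filterS (cvgr_gt _ cd _ h) => q; rewrite subr_gt0.
have stay q : (A `&` B) q -> depth q < d * height q -> (A `&` B) (step q).
  move=> [Aq Bq] /solve[q' [[Aq' Bq'] sq'] q'q].
  by have /= <- := ABinj (q', q) (conj Aq' Bq) q'q.
have ratio q : depth q < d * height q -> depth (step q) < d * height (step q).
  move=> /step_ratio h; apply: lt_le_trans h _; rewrite ler_wpM2r//.
  by rewrite ler_pdivrMr ?exprn_gt0// ler_pMr// exprn_ege1// ltW.
apply: filterS (filterI ABx small) => p [ABp pd].
have orbit j : (A `&` B) (iter j step p) /\ depth (iter j step p) < d * height (iter j step p).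
  by elim: j => [|j [ABj dj]] //=; split; [exact: stay|exact: ratio].
move=> O Ox; have OAx : nbhs x (O `&` A) by exact: filterI.
have [d' d'0 solve'] := fiber_near x0 OAx.
have hp : 0 < height p.
  rewrite -(pmulr_rgt0 _ d0); exact: le_lt_trans (depth_ge0 p) pd.
apply: filterS (iter_step_small hp d'0) => j /solve'[q' [Oq' Aq'] qq'] /=.
by have /= <- := ABinj (q', iter j step p) (conj Aq' (orbit j).1.2) qq'.
Qed.

(** By compactness, all points of ratio below some [d] already lie in basins; every orbit starting
    off the fibre over [b] gets below [d]. *)
Lemma to_fiber_exists p : 0 < height p -> exists2 x, depth x = 0 & to_fiber x p.
Proof.
move=> hp; have nc := (@compact_near_coveringP M [set: M]).1 M_compact.
have : \forall d \near (0 : R)^'+, [set: M] `<=` fun q => depth q < d * height q ->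
    exists2 x, depth x = 0 & to_fiber x q.
  apply: nc => q _; have [q0|q0] := eqVneq (depth q) 0.
    apply: filterS (near_fst (near_to_fiber q0)) => -[q' d] /= qq' _.
    by exists q.
  by apply: filterS (near_depth_gt q0) => -[q' d] /= h /h.
move=> cov; have [d [d0 covd]] := filter_ex (filterI (nbhs_right_gt (0 : R)) cov).
have [j jd] := filter_ex (iter_step_small hp d0).
have [x x0 xj] := covd _ I jd; exists x => //.
exact: iter_cvg_shift xj.
Qed.

Lemma to_fiber_open x : depth x = 0 -> open (to_fiber x).
Proof.
move=> x0; rewrite openE => p px.
have ev : \forall j \near \oo, nbhs (iter j step p) (to_fiber x).
  by exact: px _ (nbhs_interior (near_to_fiber x0)).
have [j pj] := filter_ex ev.
have near_p : \forall q \near p, to_fiber x (iter j step q).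
  exact: (@iter_continuous _ step j step_continuous p _ pj).
by apply: filterS near_p => q; exact: iter_cvg_shift.
Qed.

Lemma to_fiber_fixed x : depth x = 0 -> to_fiber x x.
Proof.
move=> x0; rewrite /to_fiber /=.
have -> : (fun j => iter j step x) = cst x.
  by apply/funext => j /=; elim: j => //= j ->; exact: step_fixed.
exact: cvg_cst.
Qed.

Lemma to_fiber_unique x y p : to_fiber x p -> to_fiber y p -> x = y.
Proof. by move=> px py; apply: (cvg_unique M_hausdorff px py). Qed.

(* The basins of the points over the ray of [a] partition the complement of the
   fibre over the ray of [b]; the latter cannot disconnect [M]. *)
Lemma fiber_unique p q : depth p = 0 -> depth q = 0 -> p = q.
Proof.
move=> p0 q0; apply: contrapT => pq.
pose A := to_fiber p.
pose C := \bigcup_(x in [set x | depth x = 0 /\ x <> p]) to_fiber x.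
have A_open : open A by exact: to_fiber_open.
have C_open : open C by apply: bigcup_open => x [x0 _]; exact: to_fiber_open.
have AC : A `&` C = set0.
  by rewrite -subset0 => y [Ay [x [_ xp]] Cy]; apply: xp; exact: to_fiber_unique Cy Ay.
have cover y : 0 < height y -> (A `|` C) y.
  move=> /to_fiber_exists[x x0 xy]; have [xp|xp] := pselect (x = p).
    by left; rewrite /A -xp.
  by right; exists x.
(* [cover] says nothing over the ray of [b]. Allowing one exceptional point per neighbourhood lets
   [ext A] and [ext C] absorb that fibre and cover [M]. *)
pose ext (B : set M) := [set z | \forall y \near z, y = z \/ B y].
have sub_ext B : open B -> B `<=` ext B.
  by move=> oB y By; apply: (filterS (P := B)) => [z Bz|]; [right|exact: open_nbhs_nbhs].
have ext_open B : open B -> open (ext B).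
  move=> oB; rewrite openE => z Bz.
  by apply: filterS (Bz) => y [->|By]; [exact: Bz|exact: sub_ext].
have ext_disjoint : ext A `&` ext C = set0.
  rewrite -subset0 => z [Az Cz].
  (* As [A] and [C] are disjoint, a point in both extensions would be isolated. *)
  have zz : nbhs z [set z].
    apply: filterS (filterI Az Cz) => y [[//|Ay] [//|Cy]].
    by have : (A `&` C) y by []; rewrite AC.
  have [V [oV Vz Vsub _ [y [Vy yz]]]] := punctured_nbhs_connected zz.
  exact: yz (Vsub _ Vy).
have ext_cover : [set: M] `<=` ext A `|` ext C.
  move=> z _; have [z0|z0] := eqVneq (height z) 0; last first.
    have [|Az|Cz] := cover z; first by rewrite lt0r z0 height_ge0.
      by left; exact: sub_ext.
    by right; exact: sub_ext.
  have [[U U'] /= [Uz Uz'] Uinj] := psi_locally_injective z.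
  have [V [oV Vz VU Vconn _]] := punctured_nbhs_connected Uz.
  (* By local injectivity [z] is the only point of [V] over the ray of [b]. The connected set [V]
     minus [z] then lies in a single one of [A] and [C]. *)
  have Vcover : V `\ z `<=` A `|` C.
    move=> y [Vy yz]; apply: cover; rewrite lt0r height_ge0 andbT.
    apply/eqP => y0; apply: yz; apply: (Uinj (y, z)).
      by split => //=; [exact: VU|exact: nbhs_singleton].
    apply: (@future_null_parallel_trans _ _ _ b) => //.
      by apply/eqP; rewrite -oppr_eq0; apply/eqP.
    by rewrite minkC; apply/eqP; rewrite -oppr_eq0; apply/eqP.
  have ext_of B : V `\ z `<=` B -> ext B z.
    move=> VB; apply: (filterS (P := V)) => [y Vy|]; last exact: open_nbhs_nbhs.
    by have [->|yz] := pselect (y = z); [left|right; apply: VB].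
  have [VA|VC] := connected_subset (open_disjoint_separated A_open C_open AC) Vcover Vconn.
    by left; exact: ext_of.
  by right; exact: ext_of.
have [MA|MC] := connected_subset
    (open_disjoint_separated (ext_open _ A_open) (ext_open _ C_open) ext_disjoint)
    ext_cover M_connected.
- have : (ext A `&` ext C) q.
    split; first exact: MA.
    by apply: sub_ext => //; exists q; [split => // /esym|exact: to_fiber_fixed].
  by rewrite ext_disjoint.
- have : (ext A `&` ext C) p.
    by split; [apply: sub_ext => //; exact: to_fiber_fixed|exact: MC].
  by rewrite ext_disjoint.
Qed.

End Dynamics.

Theorem null_directions_injective p q : minkowski (psi p) (psi q) = 0 -> p = q.
Proof.
move=> pq.
have [W [W_open W_refl W_inj]] := compact_uniform_injectivity
  (r := fun p q => minkowski (psi p) (psi q) = 0) p M_hausdorff M_compact psi_locally_injective.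
(* The attracting direction is [psi p] itself, so that [p] and [q] both lie in the fibre over it. *)
have [b b_null ab] := future_null_opposite (psi_null p).
have [k k1 /all_and2[boost_null stepP]] := boost_step (psi_null p) b_null ab W_open W_refl.
have [x|step /all_and2[W_step psi_step]] := @boolp.choice M M
    (fun x y => W (x, y) /\ minkowski (psi y) (boost (psi p) b k (psi x)) = 0).
  by have [y] := stepP x; exists y.
apply: (fiber_unique (psi_null p) b_null ab W_open W_refl W_inj k1 boost_null W_step psi_step).
  by rewrite (psi_null p).1 oppr0.
by rewrite minkC pq oppr0.
Qed.

End Injectivity.

(** * Calculus *)

Section Lines.
Context {R : realType} {V W : normedModType R}.

Lemma is_derive_line (f : V -> W) (u v : V) (s : R) : differentiable f (s *: v + u) ->
  is_derive s 1 (fun r => f (r *: v + u)) ('D_v f (s *: v + u)).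
Proof.
move=> df.
have h : (fun h : R => h^-1 *: (f ((h *: (1 : R) + s) *: v + u) - f (s *: v + u))) =
    (fun h : R => h^-1 *: (f (h *: v + (s *: v + u)) - f (s *: v + u))).
  by apply/funext => h; rewrite scaler1 scalerDl addrA.
have dv := diff_derivable (v := v) df.
by split; rewrite /derivable /derive /= h.
Qed.

End Lines.

Section Derivatives.
Context {R : realType}.

Lemma is_derive_coord {V : normedModType R} {m : nat} (f : V -> 'rV[R]_m) x v df j :
  is_derive x v f df -> is_derive x v (fun y => f y 0 j) (df 0 j).
Proof.
move=> [fd <-]; have fdj := (derivable_mxP f x v).1 fd.
by split; [exact: fdj|rewrite derive_mx// mxE].
Qed.

Lemma is_derive_mink {n : nat} {V : normedModType R} (f g : V -> 'rV[R]_n.+2) x v df dg :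
  is_derive x v f df -> is_derive x v g dg ->
  is_derive x v (fun y => minkowski (f y) (g y)) (minkowski df (g x) + minkowski (f x) dg).
Proof.
move=> fx gx.
have c j := is_derive_coord j fx.
have d j := is_derive_coord j gx.
have prod j : is_derive x v (fun y => f y 0 j * g y 0 j) (f x 0 j * dg 0 j + g x 0 j * df 0 j).
  exact: is_deriveM.
pose G (i : 'I_n.+1) := fun y : V => f y 0 (lift ord0 i) * g y 0 (lift ord0 i).
have -> : (fun y => minkowski (f y) (g y)) =
    (- (fun y => f y 0 ord0 * g y 0 ord0)) + \sum_(i < n.+1) G i.
  by apply/funext => y; rewrite /minkowski /= fctE fct_sumE.
apply: is_derive_eq; rewrite /minkowski /=.
rewrite [RHS]addrACA -opprD -big_split /=; congr (- _ + _); first by ring.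
by apply: eq_bigr => i _; ring.
Qed.

End Derivatives.

Section Jacobian.
Context {R : realType} {n m : nat} (U : set 'rV[R]_n) (f : 'rV[R]_n -> 'rV[R]_m).
Hypotheses (U_open : open U) (f_C1 : Ck 1 U f).

Lemma jacobianE u i j : U u -> ('J f u) i j = ('D_(delta_mx 0 i) f u) 0 j.
Proof.
by move=> Uu; rewrite mxE deriveE//; exact: f_C1.1.
Qed.

Lemma jacobian_near (u0 : 'rV[R]_n) (e : R) : U u0 -> 0 < e ->
  \forall u \near u0, U u /\ forall i j, `|('J f u0) i j - ('J f u) i j| < e.
Proof.
move=> Uu0 e0; have Unear : \forall u \near u0, U u by exact: open_nbhs_nbhs.
pose far (i : 'I_n) (j : 'I_m) (u : 'rV[R]_n) : R :=
  `|('D_(delta_mx 0 i) f u0) 0 j - ('D_(delta_mx 0 i) f u) 0 j|.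
have entry i j : \forall u \near u0, far i j u < e.
  have cij : ('D_(delta_mx 0 i) f u) 0 j @[u --> u0] --> ('D_(delta_mx 0 i) f u0) 0 j.
    apply: (@cvg_comp _ _ _ ('D_(delta_mx 0 i) f) (fun M : 'rV[R]_m => M 0 j)).
      exact: (f_C1.2 _ _ Uu0).
    exact: coord_continuous.
  by move/(@cvgrPdist_lt _ R^o) : cij => /(_ e e0).
have entries : \forall u \near u0, forall i j, far i j u < e.
  have FF : Filter (nbhs u0) by exact: nbhs_filter.
  have row_entries i := @filter_forall _ _ (fun j u => far i j u < e) (nbhs u0) FF (entry i).
  exact: (@filter_forall _ _ (fun i u => forall j, far i j u < e) (nbhs u0) FF row_entries).
apply: filterS (filterI Unear entries) => u [Uu uij]; split => // i j.
have e1 := jacobianE i j Uu0.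
have e2 := jacobianE i j Uu.
move: (uij i j); rewrite /far.
by rewrite -e1 -e2.
Qed.

(* The rows of [J] are evaluated at different points of the segment, one for
   each coordinate of [f]; only closeness to the Jacobian matters. *)
Lemma mean_value_matrix (u0 : 'rV[R]_n) (N : set 'M[R]_(n, m)) : U u0 -> nbhs ('J f u0) N ->
  \forall u \near u0 & u' \near u0, exists2 J, N J & f u - f u' = (u - u') *m J.
Proof.
move=> Uu0 /nbhs_ballP[e /= e0 eN].
have /nbhs_ballP[d /= d0 dU] := jacobian_near Uu0 e0.
exists (ball u0 d, ball u0 d); first by split; exact: nbhsx_ballx.
move=> [u u'] /= [ud u'd].
have segU (s : R) : s \in `[0, 1] -> ball u0 d (s *: (u - u') + u').
  rewrite in_itv/= => /andP[s0 s1]; move: ud u'd; rewrite -ball_normE /= => ud u'd.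
  have -> : u0 - (s *: (u - u') + u') = s *: (u0 - u) + (1 - s) *: (u0 - u').
    by apply/matrixP => i j; rewrite !mxE; ring.
  apply: le_lt_trans (ler_normD _ _) _; rewrite !normrZ (ger0_norm s0) ger0_norm ?subr_ge0//.
  (* The strict inequality below is taken from the term of weight [s], so [s = 0] is split off. *)
  have [->|sn0] := eqVneq s 0; first by rewrite mul0r add0r subr0 mul1r.
  have -> : d = s * d + (1 - s) * d by ring.
  by apply: ltr_leD; [rewrite ltr_pM2l// lt0r sn0|rewrite ler_wpM2l ?subr_ge0// ltW].
have mvt j : exists2 s : R, s \in `[0, 1] &
    (f u - f u') 0 j = ((u - u') *m 'J f (s *: (u - u') + u')) 0 j.
  pose g (s : R) := f (s *: (u - u') + u') 0 j.
  pose dg (s : R) := ('D_(u - u') f (s *: (u - u') + u')) 0 j.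
  have gd (s : R) : s \in `[0, 1] -> is_derive s 1 g (dg s).
    by move=> /segU /dU[Us _]; apply: is_derive_coord; apply: is_derive_line; exact: f_C1.1.
  have gc : {within `[0, 1], continuous g}.
    apply: continuous_in_subspaceT => s; rewrite inE /= => s01.
    by apply/differentiable_continuous/derivable1_diffP; have [] := gd s s01.
  have gd' (s : R) : s \in `]0, 1[ -> is_derive s 1 g (dg s).
    by move=> s01; apply: gd; exact: subset_itv_oo_cc.
  have [s s01] := MVT_segment ler01 gd' gc.
  rewrite /g scale1r scale0r add0r subrK subr0 mulr1 => gs.
  exists s => //; rewrite -deriveEjacobian; last by apply: f_C1.1; have [] := dU _ (segU _ s01).
  by rewrite mxE [(- f u') 0 j]mxE gs.
have [s sP] := boolp.choice (fun j => let: ex_intro2 s s01 e := mvt j in ex_intro _ s (conj s01 e)).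
exists (\matrix_(i, j) ('J f (s j *: (u - u') + u')) i j).
  apply: eN; split => // i j; rewrite [(\matrix_(_, _) _) i j]mxE.
  by have [_ /(_ i j)] := dU _ (segU _ (sP j).1).
rewrite /=; apply/rowP => j; rewrite (sP j).2 [LHS]mxE [RHS]mxE.
by apply: eq_bigr => i _; rewrite [(\matrix_(_, _) _) i j]mxE.
Qed.

End Jacobian.

Section NearDifferentiable.
Context {R : realType} {V W : normedModType R}.

Lemma near_eq_diff (f g : V -> W) (x : V) : (\near x, f x = g x) -> differentiable f x ->
  differentiable g x /\ 'd g x = 'd f x :> (V -> W).
Proof.
move=> fg fx; have fgx := nbhs_singleton fg.
have [cdf /eqaddoP fo] := (diff_locallyP x f).1 fx.
have go : g \o shift x = cst (g x) + 'd f x +o_ 0 id.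
  apply/eqaddoP => e e0.
  have sh : \forall h \near (0 : V), f (h + x) = g (h + x).
    by rewrite (near_shift x) sub0r; near do rewrite /= subrK; exact: fg.
  apply: filterS (filterI sh (fo e e0)) => h [fgh].
  have -> : (g \o shift x - (cst (g x) + 'd f x)) h = (f \o shift x - (cst (f x) + 'd f x)) h.
    by rewrite -[LHS]/(g (h + x) - (g x + 'd f x h)) -[RHS]/(f (h + x) - (f x + 'd f x h)) fgh fgx.
  by [].
have dg := diff_unique cdf go.
split; last exact: dg.
by apply/diff_locallyP; split; rewrite dg.
Unshelve. all: by end_near. Qed.

Lemma Ck_ext (U : set V) (k : nat) (f g : V -> W) : open U ->
  (forall x, U x -> f x = g x) -> Ck k U f -> Ck k U g.
Proof.
move=> oU; elim: k f g => [|k ih] f g fg.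
  move=> cf x Ux; have : f @ x --> f x := cf x Ux.
  rewrite (fg x Ux) => cfx; change (g @ x --> g x).
  apply: cvg_trans cfx; apply: near_eq_cvg.
  by apply: filterS (open_nbhs_nbhs (conj oU Ux)).
have near_fg x : U x -> \near x, f x = g x.
  by move=> Ux; apply: filterS (open_nbhs_nbhs (conj oU Ux)).
move=> [df cf]; split=> [x Ux|v].
  exact: (near_eq_diff (near_fg x Ux) (df x Ux)).1.
apply: ih (cf v) => x Ux; exact: near_eq_derive (near_fg x Ux).
Qed.

Lemma CkS (U : set V) (k : nat) (f : V -> W) : Ck k.+1 U f -> Ck k U f.
Proof.
elim: k f => [|k ih] f [df cf]; first by move=> x /df /differentiable_continuous.
by split=> // v; exact: ih (cf v).
Qed.

Lemma Ck_linear (U : set V) (k : nat) (a b : R) (f g : V -> W) : open U ->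
  Ck k U f -> Ck k U g -> Ck k U (a *: f + b *: g).
Proof.
move=> oU; elim: k f g => [|k ih] f g.
  move=> cf cg x Ux; apply: cvgD.
    by apply: cvgZl_tmp; exact: cf.
  by apply: cvgZl_tmp; exact: cg.
move=> [df cf] [dg cg]; split=> [x Ux|v].
  by apply: differentiableD; apply: differentiableZ; [exact: df|exact: dg].
apply: Ck_ext (ih _ _ (cf v) (cg v)) => // x Ux.
have dfv := diff_derivable (v := v) (df x Ux).
have dgv := diff_derivable (v := v) (dg x Ux).
by rewrite deriveD ?deriveZ//; exact: derivableZ.
Qed.

End NearDifferentiable.

(** * Local geometry of the Gauss map *)

Lemma hyperbolic_future_null_lt0 {R : realType} {n : nat} (x y : 'rV[R]_n.+2) :
  hyperbolic_space x -> future_null y -> minkowski y x < 0.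
Proof.
move=> [xx x0] [yy y0]; have := mink_cross_ge0 y x; rewrite xx yy => h.
have : 0 < (y 0 ord0) ^+ 2 by rewrite exprn_gt0.
have := mulr_gt0 y0 x0; nra.
Qed.

(* The hypersurface and its normal field combine into maps to the light cone; the
   direction of [light_map] is the hyperbolic Gauss map, the endpoint of the
   normal geodesic. *)
Definition light_map {R : realType} {n : nat} {T : Type} (P E : T -> 'rV[R]_n.+2) (u : T) :=
  P u + E u.
Definition opposite_light_map {R : realType} {n : nat} {T : Type} (P E : T -> 'rV[R]_n.+2)
  (u : T) := P u - E u.

Section Coordinates.
Context {R : realType} {n : nat} {U : set 'rV[R]_n} {P E : 'rV[R]_n -> 'rV[R]_n.+2}.
Hypotheses (U_open : open U) (P_C2 : Ck 2 U P) (E_C1 : Ck 1 U E).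
Hypothesis P_hyperbolic : forall u, U u -> hyperbolic_space (P u).
Hypothesis E_unit : forall u, U u -> minkowski (E u) (E u) = 1.
Hypothesis E_normal : forall u, U u -> minkowski (E u) (P u) = 0.
Hypothesis E_tangent : forall u v, U u -> minkowski (E u) ('D_v P u) = 0.

Let P_diff u : U u -> differentiable P u. Proof. exact: P_C2.1. Qed.
Let E_diff u : U u -> differentiable E u. Proof. exact: E_C1.1. Qed.

Let P_derive u v : U u -> is_derive u v P ('D_v P u).
Proof. by move=> Uu; apply/derivableP/diff_derivable/P_diff. Qed.
Let E_derive u v : U u -> is_derive u v E ('D_v E u).
Proof. by move=> Uu; apply/derivableP/diff_derivable/E_diff. Qed.

Lemma derive_const_on (g : 'rV[R]_n -> R) (c dg : R) u v : U u ->
  (forall w, U w -> g w = c) -> is_derive u v g dg -> dg = 0.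
Proof.
move=> Uu gc [_ <-]; rewrite (near_eq_derive (g := cst c)); first exact: derive_cst.
by apply: filterS (open_nbhs_nbhs (conj U_open Uu)) => w /gc.
Qed.

Lemma mink_P_dP u v : U u -> minkowski (P u) ('D_v P u) = 0.
Proof.
move=> Uu; have := is_derive_mink (P_derive v Uu) (P_derive v Uu).
move=> /(derive_const_on (c := -1) Uu) -/(_ (fun w Uw => (P_hyperbolic Uw).1)).
by rewrite minkC; lra.
Qed.

Lemma mink_E_dE u v : U u -> minkowski (E u) ('D_v E u) = 0.
Proof.
move=> Uu; have := is_derive_mink (E_derive v Uu) (E_derive v Uu).
move=> /(derive_const_on (c := 1) Uu) -/(_ (fun w Uw => E_unit Uw)).
by rewrite minkC; lra.
Qed.

Lemma mink_P_dE u v : U u -> minkowski (P u) ('D_v E u) = 0.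
Proof.
move=> Uu; have := is_derive_mink (E_derive v Uu) (P_derive v Uu).
move=> /(derive_const_on (c := 0) Uu) -/(_ (fun w Uw => E_normal Uw)).
by rewrite E_tangent// addr0 minkC.
Qed.

Local Notation F := (light_map P E).

Lemma light_map_null u : U u -> future_null (F u).
Proof.
move=> Uu; apply: normal_sum_future_null; first exact: P_hyperbolic.
  exact: E_unit.
exact: E_normal.
Qed.

Lemma light_map_C1 : Ck 1 U F.
Proof.
apply: Ck_ext (Ck_linear 1 1 U_open (CkS P_C2) E_C1) => // u _.
by rewrite -[LHS]/(1 *: P u + 1 *: E u) !scale1r.
Qed.

Lemma derive_light_map u v : U u -> 'D_v F u = 'D_v P u + 'D_v E u.
Proof. by move=> Uu; apply: deriveD; apply: diff_derivable; [exact: P_diff|exact: E_diff]. Qed.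

(** With [mink_E_dlight], this confines the differential of the null-valued map to the spacelike
    complement of [P u] and [E u], where zero norm means zero. *)
Lemma mink_P_dlight u v : U u -> minkowski (P u) ('D_v F u) = 0.
Proof. by move=> Uu; rewrite derive_light_map// minkDr mink_P_dP// mink_P_dE// addr0. Qed.

Lemma mink_E_dlight u v : U u -> minkowski (E u) ('D_v F u) = 0.
Proof. by move=> Uu; rewrite derive_light_map// minkDr E_tangent// mink_E_dE// addr0. Qed.

Section Immersed.
Context {u0 : 'rV[R]_n} (Uu0 : U u0).
Hypothesis light_immersion : forall v, 'D_v F u0 = 0 -> v = 0.

Lemma dlight_spacelike v : v != 0 -> 0 < minkowski ('D_v F u0) ('D_v F u0).
Proof.
move=> v0; have tang : minkowski ('D_v F u0) (P u0) = 0.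
  by rewrite minkC mink_P_dlight.
rewrite lt0r (hyperbolic_tangent_ge0 (P_hyperbolic Uu0) tang) andbT.
apply: contra v0 => /eqP /(hyperbolic_tangent_eq0 (P_hyperbolic Uu0) tang).
by move=> /light_immersion ->.
Qed.

(* [P u0], [E u0] and the image of the differential span the whole space. *)
Lemma normal_plane y : (forall v, minkowski ('D_v F u0) y = 0) ->
  y = - minkowski y (P u0) *: P u0 + minkowski y (E u0) *: E u0.
Proof.
(* The remainder of [y] after projection to the normal plane; the sign of the [P] term reflects
   [<P, P> = -1]. *)
move=> yT; pose r := y + minkowski y (P u0) *: P u0 - minkowski y (E u0) *: E u0.
have PP := (P_hyperbolic Uu0).1; have EE := E_unit Uu0; have EP := E_normal Uu0.
have scalar0 : (0 : R)%:M = 0 :> 'M[R]_1 by rewrite -scalemx1 scale0r.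
have rP : minkowski (P u0) r = 0.
  by rewrite /r !minkE PP (minkC (P u0) (E u0)) EP (minkC (P u0) y); ring.
have rE : minkowski (E u0) r = 0.
  by rewrite /r !minkE EP EE (minkC (E u0) y); ring.
have rT v : minkowski ('D_v F u0) r = 0.
  rewrite /r !minkE yT (minkC ('D_v _ _) (P u0)) (minkC ('D_v _ _) (E u0)).
  by rewrite mink_P_dlight// mink_E_dlight//; ring.
suff r0 : r = 0.
  by apply/eqP; rewrite -subr_eq0 opprD -scaleNr opprK addrA -/r r0.
pose T : 'M[R]_(n, n.+2) := 'J F u0.
have derT v : 'D_v F u0 = v *m T.
  by rewrite deriveEjacobian//; exact: (light_map_C1.1 _ Uu0).
(* The [1 + 1 + n] rows make [B] square, so freeness of the rows gives invertibility. *)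
pose B : 'M[R]_(n.+2) := col_mx (P u0) (col_mx (E u0) T).
have combB (w : 'rV[R]_(1 + (1 + n))) : w *m B =
    (lsubmx w) 0 0 *: P u0 + ((lsubmx (rsubmx w)) 0 0 *: E u0 + 'D_(rsubmx (rsubmx w)) F u0).
  rewrite -{1}(hsubmxK w) /B mul_row_col -{1}(hsubmxK (rsubmx w)) mul_row_col derT.
  by rewrite {1}[lsubmx w]mx11_scalar mul_scalar_mx {1}[lsubmx (rsubmx w)]mx11_scalar mul_scalar_mx.
have B_free : row_free B.
  rewrite -kermx_eq0; apply/eqP/row_matrixP => i; rewrite row0.
  have : row i (kermx B) *m B = 0 by apply/sub_kermxP; exact: row_sub.
  move: (row i _ : 'rV[R]_(1 + (1 + n))) => w; rewrite combB.
  set a := lsubmx _ 0 0; set b := lsubmx _ 0 0; set c := rsubmx _ => w0.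
  have a0 : a = 0.
    have := congr1 (minkowski (P u0)) w0.
    by rewrite !minkE PP (minkC (P u0) (E u0)) EP mink_P_dlight// mink0r; lra.
  have b0 : b = 0.
    have := congr1 (minkowski (E u0)) w0.
    by rewrite !minkE EP EE mink_E_dlight// mink0r; lra.
  have c0 : c = 0.
    by apply: light_immersion; move: w0; rewrite a0 b0 !scale0r !add0r.
  rewrite -[w](@hsubmxK _ 1 1 (1 + n)) -[rsubmx w](@hsubmxK _ 1 1 n).
  rewrite -/c c0 [lsubmx w]mx11_scalar -/a a0 [lsubmx (rsubmx w)]mx11_scalar -/b b0.
  by rewrite !scalar0 !row_mx0.
(* [r] with its index lowered: [B *m r'] lists the Minkowski products of the rows of [B] with
   [r]. *)
pose r' : 'cV[R]_n.+2 := \col_i (if i == ord0 then - r 0 i else r 0 i).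
have mulr' (x : 'rV[R]_n.+2) : x *m r' = (minkowski x r)%:M.
  apply/rowP => i; rewrite !ord1 !mxE eqxx mulr1n big_ord_recl mxE eqxx mulrN.
  by congr (_ + _); apply: eq_bigr => j _; rewrite mxE.
have Tr : T *m r' = 0.
  apply/row_matrixP => i; rewrite row_mul rowE -derT mulr' rT row0.
  by apply/matrixP => j k; rewrite !mxE mul0rn.
have Br : B *m r' = 0.
  rewrite [LHS](mul_col_mx (P u0) (col_mx (E u0) T)) mul_col_mx !mulr' rP rE Tr.
  by rewrite !scalar0 !col_mx0.
have r'0 : r' = 0.
  have B_unit : B \in unitmx by rewrite -row_free_unit.
  by rewrite -(mulKmx B_unit r') Br mulmx0.
apply/rowP => i; have := congr1 (fun M : 'cV[R]_n.+2 => M i 0) r'0.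
by rewrite !mxE; case: eqP => // _ /eqP; rewrite oppr_eq0 => /eqP.
Qed.

End Immersed.
End Coordinates.

Section Spheres.
Context {R : realType} {n : nat}.

Lemma compact_closed_ball_rV (u : 'rV[R]_n) (d : R) : compact [set v | `|u - v| <= d].
Proof.
apply: bounded_closed_compact; last exact: closed_closed_ball_.
exists (d + `|u|); split; first exact: num_real.
move=> M dM v /= uv; apply: le_trans (ltW dM).
have -> : v = u - (u - v) by rewrite opprB addrC subrK.
by apply: le_trans (ler_normB _ _) _; rewrite addrC lerD2r.
Qed.

Lemma compact_sphere_rV (u : 'rV[R]_n) (d : R) : compact [set v | `|u - v| = d].
Proof.
apply: (subclosed_compact _ (compact_closed_ball_rV (u := u) (d := d))).
  rewrite -[X in closed X]/((Num.norm \o (fun v => u - v)) @^-1` [set x | x = d]).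
  apply: (preimage_closed _ (@closed_eq _ _)) => v _.
  apply: (continuous_comp _ (@norm_continuous _ _ _)).
  exact: (continuousB (@cst_continuous _ _ _ _)).
by move=> v /= ->.
Qed.

(** By homogeneity only unit vectors matter, and their sphere is compact. Positivity rather than
    injectivity of [J] is kept, since it excludes null values of [v *m J] and not just zero. *)
Lemma spacelike_near (J0 : 'M[R]_(n, n.+2)) :
  (forall v, v != 0 -> 0 < minkowski (v *m J0) (v *m J0)) ->
  \forall J \near J0, forall v, v != 0 -> 0 < minkowski (v *m J) (v *m J).
Proof.
move=> J0_pos.
have nc := (@compact_near_coveringP _ _).1 (compact_sphere_rV (u := 0) (d := 1)).
have : \forall J \near J0, [set v : 'rV[R]_n | `|0 - v| = 1] `<=`
    fun v => 0 < minkowski (v *m J) (v *m J).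
  apply: (nc _ (nbhs J0) (fun J v => 0 < minkowski (v *m J) (v *m J))) => v /= v1.
  have v0 : v != 0 by rewrite -normr_gt0 -normrN -sub0r v1.
  have coordZ j : (z.1 *m z.2) 0 j @[z --> filter_prod (nbhs v) (nbhs J0)] --> (v *m J0) 0 j.
    rewrite [X in _ --> X]mxE; under eq_cvg do rewrite mxE.
    apply: cvg_big => [|i _]; first exact: add_continuous.
    apply: cvgM.
      apply: (@cvg_comp _ _ _ fst (fun w : 'rV[R]_n => w 0 i)); first exact: cvg_fst.
      exact: coord_continuous.
    apply: (@cvg_comp _ _ _ snd (fun J : 'M[R]_(n, n.+2) => J i j)); first exact: cvg_snd.
    exact: coord_continuous.
  exact: cvgr_gt (cvg_mink_coord coordZ coordZ) _ (J0_pos _ v0).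
apply: filterS => J Jpos v v0.
have nv : `|v| != 0 by rewrite normr_eq0.
have /Jpos : [set v : 'rV[R]_n | `|0 - v| = 1] (`|v|^-1 *: v).
  by rewrite /= sub0r normrN normrZ normfV normr_id mulVf.
rewrite -scalemxAl minkZl minkZr !pmulr_rgt0// invr_gt0 lt0r nv/=; exact: normr_ge0.
Qed.

End Spheres.

(** * Local injectivity, stability and openness *)

Section LocalGaussMap.
Context {R : realType} {n : nat} {U : set 'rV[R]_n} {P E : 'rV[R]_n -> 'rV[R]_n.+2}.
Hypotheses (U_open : open U) (P_C2 : Ck 2 U P) (E_C1 : Ck 1 U E).
Hypothesis P_hyperbolic : forall u, U u -> hyperbolic_space (P u).
Hypothesis E_unit : forall u, U u -> minkowski (E u) (E u) = 1.
Hypothesis E_normal : forall u, U u -> minkowski (E u) (P u) = 0.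
Hypothesis E_tangent : forall u v, U u -> minkowski (E u) ('D_v P u) = 0.
Hypothesis light_immersion : forall u v, U u -> 'D_v (light_map P E) u = 0 -> v = 0.

Local Notation F := (light_map P E).
Let F_C1 : Ck 1 U F. Proof. exact: light_map_C1. Qed.
Let F_null u : U u -> future_null (F u).
Proof. by move=> Uu; apply: (light_map_null P_hyperbolic E_unit E_normal). Qed.

Let F_near_spacelike u0 : U u0 ->
  \forall J \near 'J F u0, forall v, v != 0 -> 0 < minkowski (v *m J) (v *m J).
Proof.
move=> Uu0; apply: spacelike_near => v v0; rewrite -deriveEjacobian; last exact: F_C1.1.
apply: (dlight_spacelike U_open P_C2 E_C1) => // w; exact: light_immersion.
Qed.

(** If [F u] and [F u'] are parallel, their difference is null; but it equals [(u - u') *m J] with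
    [J] close to the Jacobian, which is spacelike unless [u = u']. *)
Lemma light_map_locally_injective u0 : U u0 -> \forall u \near u0 & u' \near u0,
  minkowski (F u) (F u') = 0 -> u = u'.
Proof.
move=> Uu0; have Unear : nbhs u0 U by exact: open_nbhs_nbhs.
have [[A B] /= [Au0 Bu0] ABJ] := mean_value_matrix U_open F_C1 Uu0 (F_near_spacelike Uu0).
exists (A `&` U, B `&` U); first by split; exact: filterI.
move=> [u u'] [/= [Au Uu] [Bu' Uu']] uu'; apply/eqP; rewrite -subr_eq0.
have [J Jpos /= eJ] := ABJ (u, u') (conj Au Bu').
apply/negPn/negP => /Jpos; rewrite -eJ.
by rewrite (null_sub (F_null Uu).1 (F_null Uu').1) uu' mulr0 ltxx.
Qed.

(** The neighbourhood [A] is fixed before [e], as the later covering arguments over the compact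
    manifold require. Matrices [JF + e *: JX] near the Jacobian of [F] are spacelike, hence
    injective, even when [JF] and [JX] come from different points. *)
Lemma light_map_perturbation_injective (X : 'rV[R]_n -> 'rV[R]_n.+2) u0 : Ck 1 U X -> U u0 ->
  exists2 A, nbhs u0 A & \forall e \near (0 : R), forall u u', A u -> A u' ->
    (F u + e *: X u = F u' + e *: X u' -> u = u') /\
    (forall v, 'D_v F u + e *: 'D_v X u = 0 -> v = 0).
Proof.
move=> X_C1 Uu0; have Unear : nbhs u0 U by exact: open_nbhs_nbhs.
have cJ : z.1.1 + z.2 *: z.1.2 @[z --> filter_prod (filter_prod (nbhs ('J F u0)) (nbhs ('J X u0)))
    (nbhs (0 : R))] --> 'J F u0 + 0 *: 'J X u0.
  apply: cvgD.
    by apply: (@cvg_comp _ _ _ fst fst) cvg_fst cvg_fst.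
  apply: cvgZ; first exact: cvg_snd.
  by apply: (@cvg_comp _ _ _ fst snd) cvg_fst cvg_snd.
rewrite scale0r addr0 in cJ.
have [[N T] /= [[[NF NX] /= [NFn NXn] NFX] Tn] NT] := cJ _ (F_near_spacelike Uu0).
have inj e JF JX (v : 'rV[R]_n) : T e -> NF JF -> NX JX -> v *m JF + e *: (v *m JX) = 0 -> v = 0.
  move=> Te NJF NJX vJ; apply/eqP/negPn/negP => v0.
  have := NT (JF, JX, e) (conj (NFX (JF, JX) (conj NJF NJX)) Te) v v0.
  by rewrite /= mulmxDr -scalemxAr vJ mink0l ltxx.
have [[A A'] /= [Au0 A'u0] AJ] := mean_value_matrix U_open F_C1 Uu0 NFn.
have [[B B'] /= [Bu0 B'u0] BJ] := mean_value_matrix U_open X_C1 Uu0 NXn.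
have jac (f : 'rV[R]_n -> 'rV[R]_n.+2) (N' : set 'M[R]_(n, n.+2)) :
    Ck 1 U f -> nbhs ('J f u0) N' -> \forall u \near u0, N' ('J f u).
  move=> f_C1 /nbhs_ballP[e /= e0 eN].
  apply: filterS (jacobian_near U_open f_C1 Uu0 e0) => u [_ uJ].
  by apply: eN; split => // i j; exact: uJ.
exists (U `&` ((A `&` A') `&` (B `&` B') `&` ((jacobian F) @^-1` NF `&` (jacobian X) @^-1` NX))).
  apply: filterI => //; apply: filterI; first by apply: filterI; exact: filterI.
  by apply: filterI; exact: jac.
apply: filterS Tn => e Te u u' [Uu [[[Au A'u] [Bu B'u]] [Fu Xu]]].
move=> [Uu' [[[Au' A'u'] [Bu' B'u']] _]]; split=> [eFX|v eD].
  apply/eqP; rewrite -subr_eq0; apply/eqP.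
  have [JF NJF /= eF] := AJ (u, u') (conj Au A'u').
  have [JX NJX /= eX] := BJ (u, u') (conj Bu B'u').
  apply: (inj e JF JX) => //; rewrite -eF -eX scalerBr addrACA -opprD eFX.
  exact: subrr.
move: eD; rewrite (deriveEjacobian v (F_C1.1 _ Uu)) (deriveEjacobian v (X_C1.1 _ Uu)).
exact: inj.
Qed.

(* For [y] near [y0] the function [u |-> - <F u, y>] has an interior minimum on a
   small ball; at a critical point [y] lies in the normal plane, and being null
   with [<y, E> > 0] it is a multiple of [F u] rather than of [P u - E u]. *)
Lemma light_map_open u0 O y0 : U u0 -> nbhs u0 O -> future_null y0 ->
  minkowski (F u0) y0 = 0 ->
  \forall y \near y0, future_null y -> exists2 u, U u /\ O u & minkowski (F u) y = 0.
Proof.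
move=> Uu0 Ou0 y0_null Fy0; have Unear : nbhs u0 U by exact: open_nbhs_nbhs.
have F_cont u : U u -> F w @[w --> u] --> F u.
  by move=> Uu; apply: differentiable_continuous; exact: F_C1.1.
have E_cont : E w @[w --> u0] --> E u0.
  by apply: differentiable_continuous; exact: E_C1.1.
have cF u y : U u -> minkowski (F z.1) z.2 @[z --> filter_prod (nbhs u) (nbhs y)]
    --> minkowski (F u) y.
  move=> Uu; apply: cvg_mink; last exact: cvg_snd.
  by apply: (@cvg_comp _ _ _ fst F) cvg_fst (F_cont _ Uu).
have cE : minkowski z.2 (E z.1) @[z --> filter_prod (nbhs u0) (nbhs y0)]
    --> minkowski y0 (E u0).
  apply: cvg_mink; first exact: cvg_snd.
  by apply: (@cvg_comp _ _ _ fst E) cvg_fst E_cont.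
(* Since [<y0, P + E> = 0] and [<y0, P> < 0]. This sign persists nearby and later separates the two
   null rays of the normal plane. *)
have y0E : 0 < minkowski y0 (E u0).
  have := hyperbolic_future_null_lt0 (P_hyperbolic Uu0) y0_null.
  by move: Fy0; rewrite minkC /F /light_map minkDr; lra.
have [[A Y] /= [Au0 Yy0] AY] := cvgr_gt _ cE _ y0E.
have [[B B'] /= [Bu0 B'u0] BF] := light_map_locally_injective Uu0.
have : nbhs u0 ((U `&` O) `&` (A `&` (B `&` B'))).
  by apply: filterI; [exact: filterI|apply: filterI => //; exact: filterI].
move=> /nbhs_closedballP[r]; have : 0 < r%:num by [].
move: (r%:num) => d d0; rewrite closed_ballE// => dsub.
pose K := [set v | `|u0 - v| <= d].
have Ku0 : K u0 by rewrite /K /= subrr normr0 ltW.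
have K_compact : compact K := compact_closed_ball_rV (u := u0) (d := d).
have nc := (@compact_near_coveringP _ _).1 (compact_sphere_rV (u := u0) (d := d)).
(* For [y = y0] the product is 0 at the centre and negative on the sphere, by local injectivity.
   Compactness preserves the strict inequality for nearby [y], which keeps the minimum off the
   boundary. *)
have sphere_lt : \forall y \near y0, [set v | `|u0 - v| = d] `<=`
    fun u => minkowski (F u) y - minkowski (F u0) y < 0.
  apply: (nc _ (nbhs y0) (fun y u => minkowski (F u) y - minkowski (F u0) y < 0)) => u /= ud.
  have [[Uu _] [_ [_ B'u]]] : ((U `&` O) `&` (A `&` (B `&` B'))) u.
    by apply: dsub; rewrite /closed_ball_ /= ud.
  have cd : minkowski (F z.1) z.2 - minkowski (F u0) z.2
      @[z --> filter_prod (nbhs u) (nbhs y0)] --> minkowski (F u) y0 - minkowski (F u0) y0.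
    apply: cvgB; first exact: cF.
    by apply: cvg_mink; [exact: cvg_cst|exact: cvg_snd].
  apply: cvgr_lt cd _ _; rewrite Fy0 subr0 lt_neqAle future_null_le0 ?andbT//; last exact: F_null.
  apply/eqP => Fuy0; have uu0 : u0 = u.
    apply: (BF (u0, u)) => //=; first by split => //; exact: nbhs_singleton.
    apply: (@future_null_parallel_trans _ _ _ y0) => //; try exact: F_null.
    by rewrite minkC.
  by move: ud d0; rewrite -uu0 subrr normr0 => <-; rewrite ltxx.
apply: filterS (filterI Yy0 sphere_lt) => y [Yy y_lt] y_null.
have line_in_K u v : K u -> `|u0 - u| != d -> \forall s \near (0 : R), K (s *: v + u).
  move=> Ku ud; have lt_d : `|u0 - u| < d by rewrite lt_neqAle ud.
  have cl : `|u0 - (s *: v + u)| @[s --> (0 : R)] --> `|u0 - (0 *: v + u)|.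
    apply: cvg_norm; apply: cvgB; first exact: cvg_cst.
    apply: cvgD; last exact: cvg_cst.
    by apply: cvgZr_tmp; exact: cvg_id.
  rewrite scale0r add0r in cl.
  by apply: filterS (cvgr_lt _ cl _ lt_d) => s /ltW.
have K_sub u : K u -> ((U `&` O) `&` (A `&` (B `&` B'))) u by exact: dsub.
pose g u := - minkowski (F u) y.
have g_cont : {within K, continuous g}.
  apply: continuous_in_subspaceT => u; rewrite inE => /K_sub[[Uu _] _].
  have cFy : minkowski (F w) y @[w --> u] --> minkowski (F u) y.
    exact: (cvg_mink (F_cont u Uu) (cvg_cst y)).
  exact: cvgN cFy.
have [u Ku gmin] := EVT_min_rV (ex_intro _ u0 Ku0) K_compact g_cont.
rewrite inE in Ku; have [[Uu Ou] [Au _]] := K_sub _ Ku.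
have u_interior : `|u0 - u| != d.
  apply/eqP => /y_lt /=; have := gmin u0; rewrite inE /g => /(_ Ku0); lra.
have critical v : minkowski ('D_v F u) y = 0.
  have /nbhs_ballP[e /= e0 eK] := line_in_K u v Ku u_interior.
  pose h (s : R) := g (s *: v + u).
  have K_line (s : R) : s \in `](- e), e[ -> K (s *: v + u).
    rewrite in_itv /= => es; apply: eK; rewrite /ball /= sub0r normrN.
    by rewrite ltr_norml.
  have hd (s : R) : s \in `](- e), e[ ->
      is_derive s 1 h (- (minkowski ('D_v F (s *: v + u)) y)).
    move=> /K_line/K_sub[[Us _] _].
    have dl := is_derive_line (F_C1.1 _ Us).
    have := is_derive_mink dl (is_derive_cst y s 1); rewrite mink0r addr0 => dm.
    exact: is_deriveN.
  have s0 : (0 : R) \in `](- e), e[ by rewrite in_itv /= oppr_lt0 e0.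
  have hmin (s : R) : s \in `](- e), e[ -> h 0 <= h s.
    by move=> /K_line Ks; rewrite {1}/h scale0r add0r; apply: gmin; rewrite inE.
  have e_le : - e <= e by rewrite ge0_cp// ltW.
  have d1 := derive1_at_min e_le (fun s es => @ex_derive _ _ _ _ _ _ _ (hd s es)) s0 hmin.
  have := @derive_val _ _ _ _ _ _ _ d1; rewrite (@derive_val _ _ _ _ _ _ _ (hd 0 s0)).
  by rewrite scale0r add0r => /eqP; rewrite oppr_eq0 => /eqP.
exists u => //.
have Puy := hyperbolic_future_null_lt0 (P_hyperbolic Uu) y_null.
have Euy : 0 < minkowski y (E u) by exact: (AY (u, y)).
have := normal_plane U_open P_C2 E_C1 P_hyperbolic E_unit E_normal E_tangent Uu
  (fun v => light_immersion Uu) critical.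
set a := minkowski y (P u) in Puy *; set b := minkowski y (E u) in Euy * => ey.
have PP := (P_hyperbolic Uu).1; have EE := E_unit Uu; have EP := E_normal Uu.
have ab : - a = b.
  have := y_null.1; rewrite ey !minkE PP EE EP (minkC (P u) (E u)) EP => ab0.
  have /eqP : (b - a) * (b + a) = 0 by rewrite -[RHS]ab0; ring.
  by rewrite mulf_eq0 => /orP[/eqP|/eqP]; lra.
rewrite ey ab /F /light_map !minkE PP EE EP (minkC (P u) (E u)) EP; ring.
Qed.

End LocalGaussMap.

(** * Connectedness of punctured balls *)

Section PuncturedBall.
Context {R : realType} {n : nat}.
Implicit Types u v a b : 'rV[R]_n.

Let segment a b : set 'rV[R]_n := [set s *: b + (1 - s) *: a | s in `[0, 1]].

Let segment_connected a b : connected (segment a b).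
Proof.
apply: connected_continuous_connected; first exact: segment_connected.
apply: continuous_subspaceT => s; apply: cvgD; apply: cvgZr_tmp; first exact: cvg_id.
by apply: cvgB; [exact: cvg_cst|exact: cvg_id].
Qed.

Let segment_left a b : segment a b a.
Proof. by exists 0; rewrite ?scale0r ?subr0 ?scale1r ?add0r//= in_itv /= lexx ler01. Qed.

Let segment_right a b : segment a b b.
Proof. by exists 1; rewrite ?subrr ?scale0r ?scale1r ?addr0//= in_itv /= lexx ler01. Qed.

Let segment_ball a b d c : `|a| < d -> `|b| < d -> segment a b c -> `|c| < d.
Proof.
move=> ad bd [s /=]; rewrite in_itv/= => /andP[s0 s1] <-.
apply: le_lt_trans (ler_normD _ _) _; rewrite !normrZ (ger0_norm s0) ger0_norm ?subr_ge0//.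
have [->|sn0] := eqVneq s 0; first by rewrite mul0r add0r subr0 mul1r.
have -> : d = s * d + (1 - s) * d by ring.
by apply: ltr_leD; [rewrite ltr_pM2l// lt0r sn0|rewrite ler_wpM2l ?subr_ge0// ltW].
Qed.

(** Along the segment the [i]th coordinate is [(1 - s) * a 0 i], which vanishes only at the endpoint
    [b]. *)
Let segment_neq0 a b i : a 0 i != 0 -> b != 0 -> (b 0 i = 0) -> ~ segment a b 0.
Proof.
move=> ai bn bi [s _ s0]; have := congr1 (fun M : 'rV[R]_n => M 0 i) s0.
rewrite !mxE bi mulr0 add0r => /eqP; rewrite mulf_eq0 (negbTE ai) orbF subr_eq0 => /eqP s1.
by move: s0; rewrite -s1 scale1r subrr scale0r addr0 => /eqP; rewrite (negbTE bn).
Qed.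

Lemma norm_half_delta (d : R) (j : 'I_n) : 0 < d -> `|(d / 2) *: (delta_mx 0 j : 'rV[R]_n)| < d.
Proof.
move=> d0; have c0 : 0 < d / 2 by rewrite divr_gt0.
apply: (@le_lt_trans _ _ (d / 2)); last by rewrite ltr_pdivrMr// ltr_pMr// ltr1n.
move: (d / 2) c0 => c c0; rewrite [leLHS]/Num.norm /= mx_normrE.
apply: bigmax_le => [|k _]; first exact: ltW.
rewrite !mxE normrM (gtr0_norm c0) ler_piMr ?(ltW c0)//.
by rewrite normr_nat lern1 leq_b1.
Qed.

Lemma half_delta_neq0 (d : R) (j : 'I_n) : 0 < d -> (d / 2) *: (delta_mx 0 j : 'rV[R]_n) != 0.
Proof.
move=> d0; apply/eqP => /(congr1 (fun M : 'rV[R]_n => M 0 j)); rewrite !mxE !eqxx mulr1 => /eqP.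
by rewrite gt_eqF// divr_gt0.
Qed.

(* Two points with nonzero [i]th coordinate are joined inside the punctured ball
   through a small multiple of another basis vector. *)
Lemma punctured_ball0_connected (d : R) : (1 < n)%N ->
  connected [set v : 'rV[R]_n | v != 0 /\ `|v| < d].
Proof.
move=> n1; set D := mkset _.
have [->|/set0P[a [a0 ad]]] := eqVneq D set0; first exact: connected0.
have d0 : 0 < d by apply: le_lt_trans ad.
have [i ai] : exists i, a 0 i != 0.
  apply: contrapT => /forallNP h; move/eqP: a0; apply; apply/rowP => i.
  by rewrite mxE; apply/eqP/negPn/negP/h.
have [j ji] : exists j : 'I_n, j != i.
  have [i0|i0] := eqVneq (i : nat) 0.
    by exists (Ordinal n1); rewrite -val_eqE /= i0.
  by exists (Ordinal (ltnW n1)); rewrite -val_eqE /= eq_sym.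
pose w : 'rV[R]_n := (d / 2) *: delta_mx 0 j.
have wd : `|w| < d by exact: norm_half_delta.
have w0 : w != 0 by exact: half_delta_neq0.
have wi : w 0 i = 0 by rewrite !mxE eqxx eq_sym (negbTE ji) mulr0.
have seg_sub x y k : D x -> D y -> x 0 k != 0 -> y 0 k = 0 -> segment x y `<=` D.
  move=> [x0 xd] [y0 yd] xk yk v xyv; split; last exact: segment_ball xyv.
  by apply/eqP => v0; apply: (segment_neq0 xk y0 yk); rewrite -v0.
have joined b : D b -> exists C : set 'rV[R]_n, [/\ connected C, C `<=` D, C a & C b].
  move=> Db; have [bi|bi] := eqVneq (b 0 i) 0.
    exists (segment a b); split; [exact: segment_connected|exact: (seg_sub _ _ i)| |].
      exact: segment_left.
    exact: segment_right.
  exists (segment a w `|` segment b w); split.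
  - apply: connectedU; [by exists w; split; exact: segment_right| |]; exact: segment_connected.
  - by move=> v [|]; apply: (seg_sub _ _ i).
  - by left; exact: segment_left.
  - by right; exact: segment_left.
pose C b := if pselect (D b) is left Db then sval (cid (joined b Db)) else set0.
have CP b : D b -> [/\ connected (C b), C b `<=` D, C b a & C b b].
  by move=> Db; rewrite /C; case: pselect => // Db'; exact: svalP (cid (joined b Db')).
have -> : D = \bigcup_(b in D) C b.
  apply/seteqP; split=> [b Db|v [b /CP[_ CD _ _]]]; last exact: CD.
  by exists b => //; have [] := CP b Db.
apply: bigcup_connected => [|b /CP[]//].
by exists a => b /CP[].
Qed.

End PuncturedBall.

(** * Second-order contact with the tangent horosphere *)

(** Vanishing of [dm] and of its derivative at 0 makes [dm] of size [o(s)]; the mean value theorem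
    turns this into [o(s^2)] for [m]. A second derivative at the single point 0 suffices. *)
Lemma second_order_vanishing {R : realType} (m dm : R -> R) (e : R) :
  (\forall s \near (0 : R), is_derive (s : R) 1 m (dm s)) -> dm 0 = 0 -> is_derive (0 : R) 1 dm 0 ->
  0 < e -> \forall s \near (0 : R), `|m s - m 0| <= e * s ^+ 2.
Proof.
move=> m_near dm0 ddm e0.
have dm_small : \forall s \near (0 : R), `|dm s| <= e * `|s|.
  have : (fun h : R => h^-1 *: (dm (h *: (1 : R) + 0) - dm 0)) @ 0^' --> (0 : R).
    by case: ddm => dd dv; rewrite -[X in _ --> X]dv; exact: dd.
  move=> /(@cvgrPdist_le _ R^o) /(_ e e0); rewrite near_withinE.
  apply: filterS => s small; have [->|s0] := eqVneq s 0; first by rewrite dm0 !normr0 mulr0.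
  have := small s0; rewrite scaler1 addr0 dm0 subr0 sub0r normrN normrZ normfV.
  by rewrite ler_pdivrMl ?normr_gt0// mulrC.
have /nbhs_ballP[d /= d0 dball] : nbhs (0 : R)
    [set s : R | is_derive s 1 m (dm s) /\ `|dm s| <= e * `|s|] by exact: filterI.
apply/nbhs_ballP; exists d => //= s; rewrite /ball /= sub0r normrN => sd.
have in_ball (x : R) : `|x| <= `|s| -> is_derive x 1 m (dm x) /\ `|dm x| <= e * `|x|.
  by move=> xs; apply: dball; rewrite /ball /= sub0r normrN; exact: le_lt_trans sd.
have bound (x : R) : `|x| <= `|s| -> `|dm x * s| <= e * s ^+ 2.
  move=> xs; rewrite -real_normK ?num_real// normrM expr2 mulrA ler_wpM2r//.
  by apply: le_trans (in_ball x xs).2 _; rewrite ler_wpM2l// ltW.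
have seg (a b : R) : a <= b -> (forall x, x \in `[a, b] -> `|x| <= `|s|) ->
    exists2 c, c \in `[a, b] & m b - m a = dm c * (b - a).
  move=> ab abs; apply: MVT_segment => //.
    by move=> x xab; apply: (in_ball x _).1; apply: abs; exact: subset_itv_oo_cc.
  apply: continuous_in_subspaceT => x; rewrite inE /= => /abs/in_ball[mx _].
  by apply/differentiable_continuous/derivable1_diffP; exact: ex_derive.
have [s0|s0] := leP 0 s.
  have abs (x : R) : x \in `[0, s] -> `|x| <= `|s|.
    by rewrite in_itv /= => /andP[x0 xs]; rewrite !ger0_norm.
  have [c /abs cs ->] := seg 0 s s0 abs; rewrite subr0; exact: bound.
have abs (x : R) : x \in `[s, 0] -> `|x| <= `|s|.
  by rewrite in_itv /= => /andP[xs x0]; rewrite !ler0_norm ?lerN2// ltW.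
have [c /abs cs e1] := seg s 0 (ltW s0) abs.
by rewrite distrC e1 sub0r mulrN normrN; exact: bound.
Qed.

Section HorosphereDistance.
Context {R : realType} {n : nat}.
Implicit Types x y a : 'rV[R]_n.+2.

Lemma hdist_ge0 x y : hyperbolic_space x -> hyperbolic_space y -> 0 <= hdist x y.
Proof.
move=> hx hy; apply: ln_ge0; apply: ler_wpDr; first exact: sqrtr_ge0.
exact: hyperbolic_mink_le.
Qed.

(* The nearest point is reached along the geodesic from [x] towards the centre
   of the horosphere; its distance to [x] is [`|ln (- <x, a>)|]. *)
Lemma hdist_horosphere_le x a (M := - minkowski x a) : hyperbolic_space x -> future_null a ->
  2^-1 <= M -> 0 <= hdist_set x (horosphere a) <= 2 * `|M - 1|.
Proof.
move=> hx a_null M2; have M0 : 0 < M by apply: lt_le_trans M2; rewrite invr_gt0.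
(* The coefficient of [x] is forced by [<y, a> = -1], then that of [a] by [<y, y> = -1]. *)
pose y := M^-1 *: x + ((1 - M^-1 ^+ 2) / 2) *: a.
have xa : minkowski x a = - M by rewrite opprK.
have xx := hx.1; have aa := a_null.1.
have Mn0 : M != 0 by rewrite gt_eqF.
have xy : minkowski x y = - ((M + M^-1) / 2).
  by rewrite /y !minkE xx xa; field.
have yy : minkowski y y = -1.
  by rewrite /y !minkE xx aa (minkC a x) xa; field.
have hy : hyperbolic_space y.
  by apply: hyperbolic_mink_lt0 hx yy _; rewrite xy oppr_lt0 divr_gt0// addr_gt0// invr_gt0.
have ya : minkowski y a = -1 by rewrite /y !minkE aa xa; field.
have Sy : horosphere a y by [].
have dist_le : hdist x y <= 2 * `|M - 1|.
  rewrite /hdist xy opprK /arcosh.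
  have -> : ((M + M^-1) / 2) ^+ 2 - 1 = ((M - M^-1) / 2) ^+ 2 by field.
  rewrite sqrtr_sqr.
  (* The distance is [ln M] or [ln M^-1], bounded through [ln (1 + z) <= z]. In the second case
     [M^-1 - 1 = M^-1 * (1 - M)] with [M^-1 <= 2], the origin of the factor 2. *)
  have [M1|M1] := leP 1 M.
    have Mi1 : M^-1 <= 1 by rewrite invf_le1.
    rewrite ger0_norm; last by lra.
    have -> : (M + M^-1) / 2 + (M - M^-1) / 2 = 1 + (M - 1) by field.
    by rewrite ger0_norm ?subr_ge0//; apply: le_trans (le_ln1Dx _) _; lra.
  have Mi1 : 1 < M^-1 by rewrite invf_gt1.
  have Mi2 : M^-1 <= 2 by rewrite -[leRHS]invrK lef_pV2// posrE invr_gt0.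
  rewrite ler0_norm; last by lra.
  have -> : (M + M^-1) / 2 + - ((M - M^-1) / 2) = 1 + (M^-1 - 1) by field.
  rewrite ltr0_norm ?subr_lt0//; apply: le_trans (le_ln1Dx _) _; first by lra.
  have -> : M^-1 - 1 = M^-1 * (1 - M) by field.
  by rewrite opprB ler_wpM2r// subr_ge0 ltW.
apply/andP; split.
  by apply: lb_le_inf; [exists (hdist x y), y|move=> _ [z [hz _] <-]; exact: hdist_ge0].
apply: le_trans dist_le; apply: ge_inf; last by exists y.
by exists 0 => _ [z [hz _] <-]; exact: hdist_ge0.
Qed.

End HorosphereDistance.

Section DegenerateDirection.
Context {R : realType} {n : nat} {U : set 'rV[R]_n} {P E : 'rV[R]_n -> 'rV[R]_n.+2}.
Hypotheses (U_open : open U) (P_C2 : Ck 2 U P) (E_C1 : Ck 1 U E).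
Hypothesis P_hyperbolic : forall u, U u -> hyperbolic_space (P u).
Hypothesis E_unit : forall u, U u -> minkowski (E u) (E u) = 1.
Hypothesis E_normal : forall u, U u -> minkowski (E u) (P u) = 0.
Hypothesis E_tangent : forall u v, U u -> minkowski (E u) ('D_v P u) = 0.

(** Let [m] be the product of [P] with the fixed vector [a = F u0] along the line. Differentiating
    [<P, Q> = 0] and [<E, Q> = 0] and adding gives [<dF v, Q> + <F, dQ v> = 0] at [u0], so [m] has
    zero second derivative when [dF v = 0]. *)
Lemma hdist_second_order_vanishing u0 v : U u0 -> 'D_v (light_map P E) u0 = 0 ->
  hdist_set (P (u0 + s *: v)) (horosphere (P u0 + E u0)) / s ^+ 2 @[s --> (0 : R)^'] --> (0 : R).
Proof.
move=> Uu0 Fv; pose Q := 'D_v P; pose a := P u0 + E u0.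
have Q_C1 : Ck 1 U Q := P_C2.2 v.
have P_derive u : U u -> is_derive u v P (Q u).
  by move=> Uu; apply/derivableP/diff_derivable; exact: P_C2.1.
have E_derive u : U u -> is_derive u v E ('D_v E u).
  by move=> Uu; apply/derivableP/diff_derivable; exact: E_C1.1.
have Q_derive u : U u -> is_derive u v Q ('D_v Q u).
  by move=> Uu; apply/derivableP/diff_derivable; exact: Q_C1.1.
have PQ u : U u -> minkowski (P u) (Q u) = 0.
  by move=> Uu; exact: (mink_P_dP U_open P_C2 P_hyperbolic).
have EQ u : U u -> minkowski (E u) (Q u) = 0 by move=> Uu; exact: E_tangent.
have ddP : minkowski (Q u0) (Q u0) + minkowski (P u0) ('D_v Q u0) = 0.
  exact: (derive_const_on U_open Uu0 PQ (is_derive_mink (P_derive _ Uu0) (Q_derive _ Uu0))).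
have ddE : minkowski ('D_v E u0) (Q u0) + minkowski (E u0) ('D_v Q u0) = 0.
  exact: (derive_const_on U_open Uu0 EQ (is_derive_mink (E_derive _ Uu0) (Q_derive _ Uu0))).
have aDQ : minkowski ('D_v Q u0) a = 0.
  have : minkowski ('D_v (light_map P E) u0) (Q u0) = 0 by rewrite Fv mink0l.
  rewrite (derive_light_map P_C2 E_C1 v Uu0) -/Q minkDl => FQ.
  have := congr2 +%R ddP ddE; rewrite addrACA FQ !add0r => sum0.
  by rewrite minkC (minkDl (P u0) (E u0)).
pose m (s : R) := minkowski (P (s *: v + u0)) a.
pose dm (s : R) := minkowski (Q (s *: v + u0)) a.
have line0 : (0 : R) *: v + u0 = u0 by rewrite scale0r add0r.
have U_near : \forall s \near (0 : R), U (s *: v + u0).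
  have cl : s *: v + u0 @[s --> (0 : R)] --> (0 : R) *: v + u0.
    by apply: cvgD; [apply: cvgZr_tmp; exact: cvg_id|exact: cvg_cst].
  by apply: cl; rewrite line0; exact: open_nbhs_nbhs.
have m_near : \forall s \near (0 : R), is_derive (s : R) 1 m (dm s).
  apply: filterS U_near => s Us.
  have dl := is_derive_line (P_C2.1 _ Us).
  by have := is_derive_mink dl (is_derive_cst a s 1); rewrite mink0r addr0.
have dm0 : dm 0 = 0 by rewrite /dm line0 minkC (minkDl (P u0) (E u0)) (PQ _ Uu0) (EQ _ Uu0) addr0.
have ddm : is_derive (0 : R) 1 dm 0.
  have Q0 : differentiable Q ((0 : R) *: v + u0) by rewrite line0; exact: Q_C1.1.
  have := is_derive_mink (is_derive_line Q0) (is_derive_cst a (0 : R) 1).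
  by rewrite mink0r addr0 line0 aDQ.
have a_null : future_null a by exact: (light_map_null P_hyperbolic E_unit E_normal).
have m0 : m 0 = -1.
  by rewrite /m line0 /a minkDr (P_hyperbolic Uu0).1 (minkC (P u0)) E_normal// addr0.
apply/(@cvgrPdist_le _ R^o) => e e0.
(* [e / 2] offsets the factor 2 of [hdist_horosphere_le]; the constant [2^-1] with [|s| <= 1]
   secures its hypothesis [2^-1 <= M]. *)
have e2 : 0 < e / 2 by rewrite divr_gt0.
have h2 : 0 < 2^-1 :> R by rewrite invr_gt0.
have small1 : \forall s \near (0 : R), `|s| <= 1.
  apply/nbhs_ballP; exists 1 => //= s; rewrite /ball /= sub0r normrN; exact: ltW.
have vanish_e := second_order_vanishing m_near dm0 ddm e2.
have vanish_1 := second_order_vanishing m_near dm0 ddm h2.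
apply: nbhs_dnbhs; apply: filterS (filterI (filterI U_near small1) (filterI vanish_e vanish_1)).
move=> s [[Us s1] [se s2]]; rewrite sub0r normrN (addrC u0).
(* At [s = 0] the quotient is 0, as the inverse of 0 is 0. *)
have [->|s0] := eqVneq s 0; first by rewrite expr0n /= invr0 mulr0 normr0 ltW.
have sq0 : 0 < s ^+ 2 by rewrite exprn_even_gt0.
have sq1 : s ^+ 2 <= 1 by rewrite -real_normK ?num_real// expr_le1.
have M2 : 2^-1 <= - minkowski (P (s *: v + u0)) a.
  have := le_trans s2 (ler_piMr (ltW h2) sq1).
  rewrite m0 -/(m s) ler_norml => /andP[_]; rewrite opprK => m1.
  by rewrite lerNr; lra.
have /andP[h0 hle] := hdist_horosphere_le (P_hyperbolic Us) a_null M2.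
rewrite ger0_norm; last by rewrite divr_ge0// ltW.
rewrite ler_pdivrMr//; apply: le_trans hle _; rewrite -/(m s).
have -> : - m s - 1 = - (m s - m 0) by rewrite m0; ring.
have -> : e * s ^+ 2 = 2 * (e / 2 * s ^+ 2) by field.
by rewrite normrN ler_pM2l.
Qed.

End DegenerateDirection.

(** * Compact hypersurfaces *)

Section Charts.
Context {R : realType} {n : nat} {M : topologicalType}.
Implicit Types (c d : chart R n M) (p : M).

Lemma chart_cod_nbhs c p : chart_dom c p -> nbhs (c p) (chart_cod c).
Proof.
by move=> cp; apply: open_nbhs_nbhs; split; [exact: open_chart_cod|exact: chart_map_cod].
Qed.

Lemma chart_dom_nbhs c p : chart_dom c p -> nbhs p (chart_dom c).
Proof. by move=> cp; apply: open_nbhs_nbhs; split => //; exact: open_chart_dom. Qed.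

Lemma chart_inv_nbhs c p (O : set M) : chart_dom c p -> nbhs p O ->
  nbhs (c p) (chart_inv c @^-1` O).
Proof.
move=> cp Op; apply: (chart_inv_continuous (chart_map_cod cp)).
by rewrite (chart_mapK cp).
Qed.

Lemma near_chart c p (N : set 'rV[R]_n) : chart_dom c p -> nbhs (c p) N ->
  \forall q \near p, chart_dom c q /\ N (c q).
Proof.
by move=> cp Np; apply: filterI; [exact: chart_dom_nbhs|exact: chart_map_continuous cp _ Np].
Qed.

Lemma punctured_nbhs_connected (z : M) (O : set M) c : (1 < n)%N -> chart_dom c z ->
  nbhs z O -> exists V : set M, [/\ open V, V z, V `<=` O, connected (V `\ z) & (V `\ z) !=set0].
Proof.
move=> n1 cz Oz; have : nbhs (c z) (chart_cod c `&` chart_inv c @^-1` O).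
  by apply: filterI; [exact: chart_cod_nbhs|exact: chart_inv_nbhs].
move=> /nbhs_ballP[d /= d0 dsub].
pose N : set 'rV[R]_n := [set v | v != 0 /\ `|v| < d].
have ballE v : `|v| < d -> ball (c z) d (v + c z).
  by rewrite -ball_normE /= opprD addrCA subrr addr0 normrN.
have N_image : chart_inv c @` [set v + c z | v in N] =
    (chart_dom c `&` c @^-1` ball (c z) d) `\ z.
  apply/seteqP; split=> [_ [_ [v [v0 vd] <-] <-]|p [[cp pd] pz]].
    have [Uv _] := dsub _ (ballE v vd); split.
      split; first exact: chart_inv_dom.
      by rewrite /= (chart_invK Uv); exact: ballE.
    move=> /= vz; have := chart_invK Uv; rewrite vz => /eqP.
    by rewrite -subr_eq0 opprD addrCA subrr addr0 oppr_eq0 (negbTE v0).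
  exists (c p); last exact: chart_mapK.
  exists (c p - c z); last by rewrite subrK.
  split; last by move: pd; rewrite /= -ball_normE /= distrC.
  rewrite subr_eq0; apply/eqP => e; apply: pz.
  by rewrite -(chart_mapK cp) e (chart_mapK cz).
exists (chart_dom c `&` c @^-1` ball (c z) d); split.
- rewrite openE => p [cp pd]; rewrite /interior.
  apply: (near_chart cp); apply: open_nbhs_nbhs; split => //; exact: ball_open.
- by split => //; exact: ballxx.
- move=> p [cp /dsub[_ /=]]; by rewrite (chart_mapK cp).
- rewrite -N_image; apply: connected_continuous_connected.
    apply: connected_continuous_connected; first exact: punctured_ball0_connected.
    apply: continuous_subspaceT => v.
    by apply: (@continuousD _ _ _ id (cst (c z))); [exact: cvg_id|exact: cst_continuous].
  apply: continuous_in_subspaceT => _ /set_mem[v [v0 vd] <-].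
  by apply: chart_inv_continuous; have [] := dsub _ (ballE v vd).
- pose v : 'rV[R]_n := (d / 2) *: delta_mx 0 (Ordinal n1).
  rewrite -N_image; exists (chart_inv c (v + c z)); exists (v + c z) => //; exists v => //.
  by split; [exact: half_delta_neq0|exact: norm_half_delta].
Qed.

Lemma smooth_map_continuous {m} (A : set (chart R n M)) (f : M -> 'rV[R]_m) :
  smooth_atlas A -> smooth_map A f -> continuous f.
Proof.
move=> [cover _] fs p; have [c Ac cp] := cover p.
have fc := fs c Ac 0%N (c p) (chart_map_cod cp).
have comp : f (chart_inv c (c q)) @[q --> p] --> f p.
  have fc' : (f \o chart_inv c) @ (c p) --> f p by rewrite -[in X in _ --> X](chart_mapK cp).
  by apply: (@cvg_comp _ _ _ c (f \o chart_inv c)) fc'; exact: chart_map_continuous.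
apply: cvg_trans comp; apply: near_eq_cvg.
by apply: filterS (chart_dom_nbhs cp) => q cq; rewrite (chart_mapK cq).
Qed.

(** Estimates are made in one chart around each point, while [immersion] quantifies over the whole
    atlas. By the chain rule it is enough that the differential of the transition map has trivial
    kernel, which the reverse transition shows. *)
Lemma tangent_map_chart_change {m} (A : set (chart R n M)) (f : M -> 'rV[R]_m) c d p :
  smooth_atlas A -> A c -> A d -> chart_dom c p -> chart_dom d p ->
  differentiable (f \o chart_inv c) (c p) ->
  (forall v, tangent_map c f p v = 0 -> v = 0) ->
  forall v, tangent_map d f p v = 0 -> v = 0.
Proof.
move=> [_ trans] Ac Ad cp dp df inj v.
have cd_diff : differentiable (c \o chart_inv d) (d p).
  have [diff _] := trans d c Ad Ac 1%N.
  by apply: diff; split; [exact: chart_map_cod|rewrite /= (chart_mapK dp)].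
have dc_diff : differentiable (d \o chart_inv c) (c p).
  have [diff _] := trans c d Ac Ad 1%N.
  by apply: diff; split; [exact: chart_map_cod|rewrite /= (chart_mapK cp)].
have near_overlap : \forall u \near d p, chart_cod d u /\ chart_dom c (chart_inv d u).
  by apply: filterI; [exact: chart_cod_nbhs|exact: chart_inv_nbhs dp (chart_dom_nbhs cp)].
have ptE : (c \o chart_inv d) (d p) = c p by rewrite /= (chart_mapK dp).
have diff_at : differentiable (f \o chart_inv c) ((c \o chart_inv d) (d p)) by rewrite ptE.
have f_near : \forall u \near d p,
    ((f \o chart_inv c) \o (c \o chart_inv d)) u = (f \o chart_inv d) u.
  by apply: filterS near_overlap => u [_ cu] /=; rewrite (chart_mapK cu).
have id_near : \forall u \near d p, ((d \o chart_inv c) \o (c \o chart_inv d)) u = id u.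
  by apply: filterS near_overlap => u [du cu] /=; rewrite (chart_mapK cu) (chart_invK du).
have dc_diff' : differentiable (d \o chart_inv c) ((c \o chart_inv d) (d p)) by rewrite ptE.
have [_ dE] := near_eq_diff f_near (differentiable_comp cd_diff diff_at).
have [_ idE] := near_eq_diff id_near (differentiable_comp cd_diff dc_diff').
(* The base point is generalised because the chain rule produces [c (chart_inv d (d p))], equal to
   [c p] only propositionally. *)
have inj' x w : x = c p -> 'd (f \o chart_inv c) x w = 0 -> w = 0 by move=> ->; exact: inj.
have fE : 'd (f \o chart_inv d) (d p) v =
    'd (f \o chart_inv c) ((c \o chart_inv d) (d p)) ('d (c \o chart_inv d) (d p) v).
  exact: (congr1 (@^~ v) (etrans dE (diff_comp cd_diff diff_at))).
rewrite /tangent_map fE => /(inj' _ _ ptE) w0.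
have vE : 'd id (d p) v =
    'd (d \o chart_inv c) ((c \o chart_inv d) (d p)) ('d (c \o chart_inv d) (d p) v).
  exact: (congr1 (@^~ v) (etrans idE (diff_comp cd_diff dc_diff'))).
have idv : 'd id (d p) v = v := congr1 (@^~ v) (@diff_val _ _ _ _ _ _ _ (is_diff_id (d p))).
have lin0 (w : 'rV[R]_n) : w = 0 -> 'd (d \o chart_inv c) ((c \o chart_inv d) (d p)) w = 0.
  by move=> ->; exact: linear0.
exact: (etrans (esym idv) (etrans vE (lin0 _ w0))).
Qed.

End Charts.

Section Hypersurface.
Context {R : realType} {n : nat} {M : topologicalType} {A : set (chart R n M)}.
Context {phi eta : M -> 'rV[R]_n.+2}.
Hypotheses (n_ge2 : (2 <= n)%N) (M_manifold : smooth_manifold A).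
Hypotheses (M_compact : compact [set: M]) (M_connected : connected [set: M]).
Hypothesis phi_immersed : immersed_hypersurface A phi.
Hypothesis eta_normal : unit_normal_field A phi eta.
Hypothesis phi_second_order : forall p, nonvanishing_second_order A phi eta p.

Let atlas : smooth_atlas A. Proof. by case: M_manifold. Qed.
Let M_hausdorff : hausdorff_space M. Proof. by case: M_manifold. Qed.
Let phi_smooth : smooth_map A phi. Proof. by case: phi_immersed => -[]. Qed.
Let eta_smooth : smooth_map A eta. Proof. by case: eta_normal. Qed.
Let phi_hyperbolic p : hyperbolic_space (phi p). Proof. by case: phi_immersed. Qed.
Let eta_unit p : minkowski (eta p) (eta p) = 1. Proof. by case: eta_normal. Qed.
Let eta_phi p : minkowski (eta p) (phi p) = 0. Proof. by case: eta_normal. Qed.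

Local Notation psi := (light_map phi eta).
Local Notation chi := (opposite_light_map phi eta).

Lemma psi_null p : future_null (psi p).
Proof. exact: normal_sum_future_null. Qed.

Lemma chi_null p : future_null (chi p).
Proof.
apply: normal_sum_future_null => //; first by rewrite minkNl minkNr opprK.
by rewrite minkNl eta_phi oppr0.
Qed.

Let phi_continuous : continuous phi. Proof. exact: smooth_map_continuous atlas phi_smooth. Qed.
Let eta_continuous : continuous eta. Proof. exact: smooth_map_continuous atlas eta_smooth. Qed.

Let psi_continuous : continuous psi.
Proof. by move=> p; apply: cvgD; [exact: phi_continuous|exact: eta_continuous]. Qed.

Let chi_continuous : continuous chi.
Proof. by move=> p; apply: cvgB; [exact: phi_continuous|exact: eta_continuous]. Qed.

Section InChart.
Context {c : chart R n M} (Ac : A c).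

Let U := chart_cod c.
Let P := phi \o chart_inv c.
Let E := eta \o chart_inv c.

Let U_open : open U. Proof. exact: open_chart_cod. Qed.
Let P_C2 : Ck 2 U P. Proof. exact: phi_smooth. Qed.
Let E_C1 : Ck 1 U E. Proof. exact: eta_smooth. Qed.
Let P_hyperbolic u : U u -> hyperbolic_space (P u).
Proof. by move=> _; exact: phi_hyperbolic. Qed.
Let E_unit u : U u -> minkowski (E u) (E u) = 1.
Proof. by move=> _; exact: eta_unit. Qed.
Let E_normal u : U u -> minkowski (E u) (P u) = 0.
Proof. by move=> _; exact: eta_phi. Qed.

Let E_tangent u v : U u -> minkowski (E u) ('D_v P u) = 0.
Proof.
move=> Uu; have [_ _ _ /(_ c (chart_inv c u) v Ac (chart_inv_dom Uu))] := eta_normal.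
by rewrite /tangent_map (chart_invK Uu) deriveE//; exact: P_C2.1.
Qed.

Lemma light_immersion u v : U u -> 'D_v (light_map P E) u = 0 -> v = 0.
Proof.
move=> Uu Fv; apply: contrapT => /eqP v0.
have := phi_second_order Ac (chart_inv_dom Uu) v0; apply.
rewrite (chart_invK Uu).
exact: (hdist_second_order_vanishing U_open P_C2 E_C1 P_hyperbolic E_unit E_normal E_tangent Uu Fv).
Qed.

Lemma psi_open_in_chart p (O : set M) y0 : chart_dom c p -> nbhs p O -> future_null y0 ->
  minkowski (psi p) y0 = 0 ->
  \forall y \near y0, future_null y -> exists2 q, O q & minkowski (psi q) y = 0.
Proof.
move=> cp Op y0_null py0.
have Fy0 : minkowski (light_map P E (c p)) y0 = 0 by rewrite /light_map /P /E /= (chart_mapK cp).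
have := light_map_open U_open P_C2 E_C1 P_hyperbolic E_unit E_normal E_tangent light_immersion
  (chart_map_cod cp) (chart_inv_nbhs cp Op) y0_null Fy0.
by apply: filterS => y sol /sol[u [_ Ou] uy]; exists (chart_inv c u).
Qed.

Lemma psi_locally_injective_in_chart p : chart_dom c p -> \forall q \near p & q' \near p,
  minkowski (psi q) (psi q') = 0 -> q = q'.
Proof.
move=> cp.
have [[N N'] /= [Np N'p] inj] := light_map_locally_injective U_open P_C2 E_C1 P_hyperbolic E_unit
  E_normal E_tangent light_immersion (chart_map_cod cp).
exists ([set q | chart_dom c q /\ N (c q)], [set q | chart_dom c q /\ N' (c q)]).
  by split; exact: near_chart.
move=> [q q'] /= [[cq Nq] [cq' N'q']] qq'.
rewrite -(chart_mapK cq) -(chart_mapK cq'); congr (chart_inv c _).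
apply: (inj (c q, c q')) => //=.
by rewrite /light_map /P /E /= (chart_mapK cq) (chart_mapK cq').
Qed.

Lemma perturbed_psi_in_chart p : chart_dom c p ->
  exists2 N, nbhs p N & \forall e \near (0 : R), forall q q', N q -> N q' ->
    (psi q + e *: chi q = psi q' + e *: chi q' -> q = q') /\
    (forall v, tangent_map c (fun r => psi r + e *: chi r) q v = 0 -> v = 0).
Proof.
move=> cp.
have X_C1 : Ck 1 U (chi \o chart_inv c).
  apply: Ck_ext (Ck_linear 1 (-1) U_open (CkS P_C2) E_C1) => // u _.
  by rewrite -[LHS]/(1 *: P u + (-1) *: E u) scale1r scaleN1r.
have F_C1 : Ck 1 U (light_map P E) by exact: light_map_C1.
have [N Np near_e] := light_map_perturbation_injective U_open P_C2 E_C1 P_hyperbolic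
  E_normal E_tangent light_immersion X_C1 (chart_map_cod cp).
exists [set q | chart_dom c q /\ N (c q)]; first exact: near_chart.
apply: filterS near_e => e inj q q' [cq Nq] [cq' Nq'].
have [injF injD] := inj _ _ Nq Nq'; split=> [qq'|v].
  rewrite -(chart_mapK cq) -(chart_mapK cq'); congr (chart_inv c _); apply: injF.
  by rewrite /light_map /P /E /= (chart_mapK cq) (chart_mapK cq').
have dF : differentiable (light_map P E) (c q) by apply: F_C1.1; exact: chart_map_cod.
have dX : differentiable (chi \o chart_inv c) (c q) by apply: X_C1.1; exact: chart_map_cod.
have sumE : (fun r => psi r + e *: chi r) \o chart_inv c =
  light_map P E + e *: (chi \o chart_inv c) by [].
have dFv := diff_derivable (v := v) dF; have dXv := diff_derivable (v := v) dX.
have sumD : 'D_v (light_map P E + e *: (chi \o chart_inv c)) (c q) =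
    'D_v (light_map P E) (c q) + e *: 'D_v (chi \o chart_inv c) (c q).
  exact: (etrans (deriveD dFv (derivableZ (k := e) dXv)) (congr1 (fun w => _ + w) (deriveZ e dXv))).
have tE : 'D_v (light_map P E + e *: (chi \o chart_inv c)) (c q) =
    tangent_map c (fun r => psi r + e *: chi r) q v.
  exact: (deriveE v (differentiableD dF (differentiableZ e dX))).
by rewrite -tE sumD; exact: injD.
Qed.

End InChart.

(** Equality of vectors, not of directions, is the form that survives perturbation: [psi + e *: chi]
    is no longer null for [e != 0]. *)
Lemma psi_injective p q : psi p = psi q -> p = q.
Proof.
move=> pq; apply: (null_directions_injective (psi := psi)) => //.
- exact: psi_null.
- move=> r O y0; have [c Ac cr] := atlas.1 r; exact: (psi_open_in_chart Ac cr).
- move=> r; have [c Ac cr] := atlas.1 r; exact: (psi_locally_injective_in_chart Ac cr).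
- by move=> z O Oz; have [c Ac cz] := atlas.1 z; exact: (punctured_nbhs_connected n_ge2 cz Oz).
- by rewrite pq (psi_null q).1.
Qed.

(** Compactness of [M * M]: diagonal points are handled by the local perturbation lemma, the others
    by [psi p != psi q] and continuity. *)
Lemma perturbed_psi_injective :
  \forall e \near (0 : R), forall p q, psi p + e *: chi p = psi q + e *: chi q -> p = q.
Proof.
have MM_compact : compact [set: M * M] by rewrite -setXTT; exact: compact_setX.
have nc := (@compact_near_coveringP _ _).1 MM_compact.
have : \forall e \near (0 : R), [set: M * M] `<=`
    fun z => psi z.1 + e *: chi z.1 = psi z.2 + e *: chi z.2 -> z.1 = z.2.
  apply: (nc _ (nbhs (0 : R)) (fun e z => _)) => -[p q] _.
  have [<-|pq] := pselect (p = q).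
    have [c Ac cp] := atlas.1 p; have [N Np near_e] := perturbed_psi_in_chart Ac cp.
    exists (N `*` N, [set e | forall q q', N q -> N q' ->
      (psi q + e *: chi q = psi q' + e *: chi q' -> q = q') /\
      (forall v, tangent_map c (fun r => psi r + e *: chi r) q v = 0 -> v = 0)]).
      by split => //=; exists (N, N).
    by move=> [[p' q'] e] /= [[Np' Nq'] /(_ _ _ Np' Nq')[]].
  have cd : (psi z.1.1 + z.2 *: chi z.1.1) - (psi z.1.2 + z.2 *: chi z.1.2)
      @[z --> filter_prod (nbhs (p, q)) (nbhs (0 : R))] -->
      (psi p + (0 : R) *: chi p) - (psi q + (0 : R) *: chi q).
    have cv (f : M -> 'rV[R]_n.+2) (g : M * M -> M) x : continuous f -> g @ nbhs (p, q) --> x ->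
        f (g z.1) @[z --> filter_prod (nbhs (p, q)) (nbhs (0 : R))] --> f x.
      move=> fc gx; have c1 : z.1 @[z --> filter_prod (nbhs (p, q)) (nbhs (0 : R))] --> nbhs (p, q).
        exact: cvg_fst.
      have c2 := @cvg_comp _ _ _ fst g _ _ _ c1 gx.
      exact: (@cvg_comp _ _ _ (fun z => g z.1) f _ _ _ c2 (fc x)).
    apply: cvgB; apply: cvgD.
    - by apply: (cv psi fst) => //; exact: cvg_fst.
    - by apply: cvgZ; [exact: cvg_snd|apply: (cv chi fst) => //; exact: cvg_fst].
    - by apply: (cv psi snd) => //; exact: cvg_snd.
    - by apply: cvgZ; [exact: cvg_snd|apply: (cv chi snd) => //; exact: cvg_snd].
  rewrite !scale0r !addr0 in cd.
  have : 0 < `|psi p - psi q| by rewrite normr_gt0 subr_eq0; apply/eqP => /psi_injective.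
  move=> /(cvgr_gt _ (cvg_norm cd)); apply: filterS => -[[p' q'] e] /= h eq.
  by move: h; rewrite eq subrr normr0 ltxx.
by apply: filterS => e inj p q; exact: (inj (p, q) I).
Qed.

Lemma smooth_map_combination (a b : R) : smooth_map A (fun p => a *: phi p + b *: eta p).
Proof.
move=> c Ac k; have cod_open : open (chart_cod c) by exact: open_chart_cod.
by apply: Ck_ext (Ck_linear a b cod_open (phi_smooth Ac k) (eta_smooth Ac k)).
Qed.

Lemma perturbed_psi_differentiable (e : R) c p : A c -> chart_dom c p ->
  differentiable ((fun r => psi r + e *: chi r) \o chart_inv c) (c p).
Proof.
move=> Ac cp.
have -> : (fun r => psi r + e *: chi r) = (fun r => (1 + e) *: phi r + (1 - e) *: eta r).
  apply/funext => r; rewrite /light_map /opposite_light_map scalerBr !scalerDl !scale1r scaleNr.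
  by rewrite addrACA.
have [diff _] := smooth_map_combination (1 + e) (1 - e) Ac 1%N.
by apply: diff; exact: chart_map_cod.
Qed.

Lemma perturbed_psi_immersion :
  \forall e \near (0 : R), forall c p v, A c -> chart_dom c p ->
    tangent_map c (fun r => psi r + e *: chi r) p v = 0 -> v = 0.
Proof.
have nc := (@compact_near_coveringP _ _).1 M_compact.
have : \forall e \near (0 : R), [set: M] `<=` fun p => forall c v, A c -> chart_dom c p ->
    tangent_map c (fun r => psi r + e *: chi r) p v = 0 -> v = 0.
  apply: (nc _ (nbhs (0 : R)) (fun e p => _)) => p _.
  have [c Ac cp] := atlas.1 p; have [N Np near_e] := perturbed_psi_in_chart Ac cp.
  exists (N `&` chart_dom c, [set e | forall q q', N q -> N q' ->
      (psi q + e *: chi q = psi q' + e *: chi q' -> q = q') /\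
      (forall v, tangent_map c (fun r => psi r + e *: chi r) q v = 0 -> v = 0)]).
    by split => //; apply: filterI => //; exact: chart_dom_nbhs.
  move=> [q e] /= [[Nq cq] /(_ _ _ Nq Nq)[_ inj]] d v Ad dq.
  apply: (tangent_map_chart_change atlas Ac Ad cq dq _ inj).
  exact: perturbed_psi_differentiable.
by apply: filterS => e imm c p v Ac cp; exact: (imm p I c v Ac cp).
Qed.

Lemma normal_flow_perturbation t p : normal_flow phi eta t p =
  (expR t / 2) *: (psi p + expR (- t) ^+ 2 *: chi p).
Proof.
have tt : expR t * expR (- t) = 1 by rewrite expRN divff// expR_eq0.
rewrite /normal_flow /cosh /sinh /light_map /opposite_light_map; apply/rowP => i; rewrite !mxE.
have -> : expR t / 2 * (phi p 0 i + eta p 0 i + expR (- t) ^+ 2 * (phi p 0 i - eta p 0 i)) =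
    (expR t * (phi p 0 i + eta p 0 i) +
      (expR t * expR (- t)) * expR (- t) * (phi p 0 i - eta p 0 i)) / 2 by field.
by rewrite tt; field.
Qed.

Lemma normal_flow_hyperbolic t p : hyperbolic_space (normal_flow phi eta t p).
Proof.
have tt : expR t * expR (- t) = 1 by rewrite expRN divff// expR_eq0.
have [xx x0] := phi_hyperbolic p.
split; last first.
  rewrite normal_flow_perturbation !mxE mulr_gt0 ?divr_gt0 ?expR_gt0//.
  rewrite addr_gt0 ?mulr_gt0 ?exprn_gt0 ?expR_gt0//.
    by have [_] := psi_null p; rewrite mxE.
  by have [_] := chi_null p; rewrite !mxE.
rewrite /normal_flow !minkE xx eta_unit eta_phi (minkC (phi p)) eta_phi /cosh /sinh.
by transitivity (- (expR t * expR (- t))); [field|rewrite tt].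
Qed.

End Hypersurface.

(** The complement of [U] is compact, so its image is closed; [W] is the complement of that
    image. *)
Lemma compact_injective_open {R : realType} {m : nat} {M : topologicalType}
  (f : M -> 'rV[R]_m) (U : set M) : compact [set: M] -> continuous f -> injective f -> open U ->
  exists2 W : set 'rV[R]_m, open W & f @` U = range f `&` W.
Proof.
move=> cptM fc finj oU; exists (~` (f @` ~` U)).
  apply: closed_openC; apply: compact_closed; first exact: norm_hausdorff.
  apply: continuous_compact; first exact: continuous_subspaceT.
  exact: (subclosed_compact (open_closedC oU) cptM).
apply/seteqP; split=> [_ [p Up <-]|_ [[p _ <-] nU]].
  by split; [exists p|move=> [q nUq /finj qp]; apply: nUq; rewrite qp].
by exists p => //; apply: contrapT => nUp; apply: nU; exists p.
Qed.

Theorem proposition1p1 (R : realType) (n : nat) (n_ge2 : (2 <= n)%N)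
  (M : topologicalType) (A : set (chart R n M))
  (M_manifold : smooth_manifold A)
  (M_compact : compact [set: M]) (M_connected : connected [set: M])
  (phi eta : M -> 'rV[R]_n.+2)
  (phi_immersed : immersed_hypersurface A phi)
  (eta_normal : unit_normal_field A phi eta)
  (phi_convex : horospherically_convex A phi eta)
  (eta_orientation : orientation_convention A phi eta) :
  \forall t \near +oo, embedded_hypersurface A (normal_flow phi eta t).
Proof.
have second_order p : nonvanishing_second_order A phi eta p by case: (phi_convex p).
(* Statements for [e] near 0 become statements for large [t] through [e = exp (-2t)]. *)
have to0 : expR (- t) ^+ 2 @[t --> +oo] --> (0 : R).
  have h := @cvgr_expR R; rewrite -[X in _ --> X](mulr0 (0 : R)).
  exact: (cvgM h h).
pose g (e : R) (p : M) := light_map phi eta p + e *: opposite_light_map phi eta p.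
have inj : \forall t \near +oo, injective (g (expR (- t) ^+ 2)).
  exact: to0 _ (perturbed_psi_injective n_ge2 M_manifold M_compact M_connected
    phi_immersed eta_normal second_order).
pose immersive (e : R) := forall c p v, A c -> chart_dom c p ->
  tangent_map c (g e) p v = 0 -> v = 0.
have imm0 : \forall e \near (0 : R), immersive e.
  exact: (perturbed_psi_immersion M_manifold M_compact phi_immersed eta_normal second_order).
have imm : \forall t \near +oo, immersive (expR (- t) ^+ 2).
  by move: (to0 immersive imm0); rewrite nearE; apply.
apply: filterS (filterI inj imm) => t [inj_t imm_t].
have flowE : normal_flow phi eta t =
    (fun p => (expR t / 2) *: g (expR (- t) ^+ 2) p).
  by apply/funext => p; exact: normal_flow_perturbation.
have k0 : expR t / 2 != 0 by rewrite mulf_neq0 ?expR_eq0// invr_eq0.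
have flow_inj : injective (normal_flow phi eta t).
  by rewrite flowE => p q /(scalerI k0)/inj_t.
have flow_smooth : smooth_map A (normal_flow phi eta t).
  exact: (smooth_map_combination phi_immersed eta_normal).
split; last by move=> p; exact: (normal_flow_hyperbolic phi_immersed eta_normal).
have flow_continuous : continuous (normal_flow phi eta t).
  by apply: smooth_map_continuous flow_smooth; case: M_manifold.
split; [|exact: flow_inj|by move=> U; exact: compact_injective_open].
split; first exact: flow_smooth.
move=> c p v Ac cp.
rewrite flowE /tangent_map => dv.
have diff := perturbed_psi_differentiable phi_immersed eta_normal (expR (- t) ^+ 2) Ac cp.
apply: (imm_t c p v Ac cp); apply: (scalerI k0); rewrite scaler0 -[RHS]dv.
exact: (congr1 (@^~ v) (esym (diffZ (expR t / 2) diff))).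
Qed.
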